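(* Let $\Omega\subset\mathbb{R}^2$ have constant width equal to $1$ and let $R$ be the Reuleaux triangle of width $1$, with inradius $r(R)=\frac{3-\sqrt3}{3}=1-\frac{\sqrt3}{3}$. For every $t\ge 0$, $$|\partial \Omega_{-t}|\;\ge\;|\partial R_{-t}|.$$ Moreover, if for some $t\in(0,r(R)]$ the equality $|\partial \Omega_{-t}|=|\partial R_{-t}|$ holds, then $\Omega=R$ (up to a rigid motion of the plane).
   Context: A supporting line of a planar compact convex set $K$ is a line which intersects $K$ but does not separate any two points of $K$. A planar compact convex set has constant width $w$ if the distance between any two parallel supporting lines of it (one on each side) equals $w$, regardless of their orientation. The Reuleaux triangle $R$ of width $1$ is the intersection of the three closed disks of radius $1$ centered at the vertices of an equilateral triangle of side length $1$; it is determined up to rigid motions. For a planar compact convex set $\Omega$ and $t\ge 0$, the inner parallel set at distance $t$ is $\Omega_{-t}=\{x\in\Omega : d(x,\partial\Omega)\ge t\}$, where $d$ is the Euclidean distance. $|\partial E|$ denotes the perimeter of a convex set $E$; the perimeter of the empty set and of a single point is $0$. The inradius $r(K)$ is the radius of the largest disk contained in $K$. *)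

(* Defs.v *)
From HB Require Import structures.
From mathcomp Require Import all_boot all_order all_algebra.
From mathcomp Require Import all_classical all_reals all_analysis.

Set Implicit Arguments.
Unset Strict Implicit.
Unset Printing Implicit Defensive.

Import Order.TTheory GRing.Theory Num.Theory.
Import numFieldNormedType.Exports.

Local Open Scope classical_set_scope.
Local Open Scope ring_scope.

(* The plane is 'rV[R]_2.  The library's norm on 'rV[R]_2 is the sup norm; it
   is used only through the topology (compact, closure, interior), which is the
   Euclidean one.  All distances below are Euclidean and go through enorm. *)

Definition dot (R : realType) (x y : 'rV[R]_2) : R :=
  \sum_(i < 2) x 0 i * y 0 i.

Definition enorm (R : realType) (x : 'rV[R]_2) : R := Num.sqrt (dot x x).

Definition disk (R : realType) (x : 'rV[R]_2) (r : R) : set 'rV[R]_2 :=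
  [set y | enorm (y - x) <= r].

(* The value is the usual one only for nonempty A and B (inf of the empty set
   is 0); the boundary of a nonempty compact set and lines are nonempty. *)
Definition set_dist (R : realType) (A B : set 'rV[R]_2) : R :=
  inf [set d | exists x y, [/\ A x, B y & d = enorm (x - y)]].

Definition bdry (R : realType) (K : set 'rV[R]_2) : set 'rV[R]_2 :=
  closure K `\` interior K.

Definition compact_convex (R : realType) (K : set 'rV[R]_2) : Prop :=
  [/\ K !=set0, compact K & convex_set K].

(* For u != 0 these are exactly the lines of the plane, and two lines are
   parallel iff they can be written with the same u. *)
Definition line (R : realType) (u : 'rV[R]_2) (c : R) : set 'rV[R]_2 :=
  [set x | dot u x = c].

Definition separates (R : realType) (u : 'rV[R]_2) (c : R)
    (x y : 'rV[R]_2) : Prop :=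
  dot u x < c < dot u y \/ dot u y < c < dot u x.

Definition supporting_line (R : realType) (K : set 'rV[R]_2)
    (u : 'rV[R]_2) (c : R) : Prop :=
  [/\ u != 0, line u c `&` K !=set0 &
      forall x y, K x -> K y -> ~ separates u c x y].

(* The hypothesis on dot u x says that the two parallel supporting lines lie
   one on each side of K. *)
Definition constant_width (R : realType) (K : set 'rV[R]_2) (w : R) : Prop :=
  forall (u : 'rV[R]_2) (c1 c2 : R),
    supporting_line K u c1 -> supporting_line K u c2 ->
    (forall x, K x -> c1 <= dot u x <= c2) ->
    set_dist (line u c1) (line u c2) = w.

Definition reuleaux (R : realType) (a b c : 'rV[R]_2) : set 'rV[R]_2 :=
  disk a 1 `&` disk b 1 `&` disk c 1.

Definition inner_parallel (R : realType) (K : set 'rV[R]_2) (t : R) :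
    set 'rV[R]_2 :=
  [set x | K x /\ t <= set_dist [set x] (bdry K)].

Definition inradius (R : realType) (K : set 'rV[R]_2) : R :=
  sup [set r | 0 <= r /\ exists x, disk x r `<=` K].

(* Twice the signed area of the triangle p q r, positive when it is
   counterclockwise. *)
Definition orient (R : realType) (p q r : 'rV[R]_2) : R :=
  (q - p) 0 0 * (r - p) 0 1 - (q - p) 0 1 * (r - p) 0 0.

(* s lists the vertices of a strictly convex polygon counterclockwise.  For
   size s <= 2 this is no condition: such a list is a point or a segment, the
   latter traversed back and forth by polygon_length. *)
Definition convex_polygon (R : realType) (s : seq 'rV[R]_2) : Prop :=
  forall i j k : nat, (i < j < k)%N -> (k < size s)%N ->
    0 < orient s`_i s`_j s`_k.

Definition polygon_length (R : realType) (s : seq 'rV[R]_2) : R :=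
  \sum_(i < size s) enorm (s`_(i.+1 %% size s) - s`_i).

(* Length of the boundary curve of a convex set E: the supremum of the lengths
   of the convex polygons inscribed in it.  It is 0 for the empty set and for a
   point, and twice the length for a segment. *)
Definition perimeter (R : realType) (E : set 'rV[R]_2) : \bar R :=
  ereal_sup [set (polygon_length s)%:E | s in
    [set s | convex_polygon s /\ {in s, forall p, bdry E p}]].

Definition rigid_motion (R : realType) (f : 'rV[R]_2 -> 'rV[R]_2) : Prop :=
  exists (Q : 'M[R]_2) (v : 'rV[R]_2),
    [/\ Q *m Q^T = 1%:M, \det Q = 1 & forall x, f x = x *m Q + v].

(* Main.v *)
Require Import Defs.
From HB Require Import structures.
From mathcomp Require Import all_boot all_order all_algebra.
From mathcomp Require Import all_classical all_reals all_analysis.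
From mathcomp Require Import ring lra.

Set Implicit Arguments.
Unset Strict Implicit.
Unset Printing Implicit Defensive.

Import Order.TTheory GRing.Theory Num.Theory.
Import numFieldNormedType.Exports.

Local Open Scope classical_set_scope.
Local Open Scope ring_scope.

(** Put [s = 1 - t]. A disk of radius [t] lies in a body [K] of constant width
    [1] if and only if its centre is within [s] of all points of [K], so the
    inner parallel body [X] of [K] is the intersection of the disks of radius
    [s] about the points of [K] ([inner_parallel_dual]). Its boundary consists of
    arcs of radius [s] and of corners. If the normal cones of the corners have
    widths [2 * B], summing up to [W], then the perimeter is [s * (2 * pi - W)],
    and the problem is to bound [W] from above.

    At a corner, circles about two points [p] and [q] of [K] meet, at distance
    [2 * s * sin B <= 1] from each other. Between them the boundary of [K] is at
    least as long as the unit arc over the chord, whose angle [2 * A] satisfies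
    [sin A = s * sin B] ([jump_arclen]). By Barbier's theorem ([arclenD2pi]) the
    boundary of [K] has length [pi], so the angles [2 * A] sum up to at most [pi].
    The ratio [B / A] increases with the chord ([arc_ratio_lt]) and is therefore
    at most its value [Bs / (pi / 6)] for the unit chord. This gives
    [W <= 6 * Bs] and the perimeter is at least [2 * pi * s - 6 * s * Bs]
    ([perimeter_lower_bound]). For the Reuleaux triangle [X] is an intersection
    of three disks, and this value is also an upper bound
    ([three_disks_perimeter]).

    If [t > 0] and equality holds, all of the boundary of [K] is taken up by
    corners with unit chord. There are three of them, end to end, so [K] contains
    an equilateral triangle of side [1] and is its Reuleaux triangle
    ([three_wide_jumps], [near_triangle], [width_one_reuleaux]).

    There may be infinitely many corners, and the perimeter is a supremum over
    inscribed polygons. The lower bound is therefore obtained by walking around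
    [X] through finitely many directions whose extreme point lies on a circle
    about a point of [K], its foot. Either the next such direction is close, and
    then the displacements of extreme point, normal and foot are compared
    ([step_length]), or a corner is jumped over; that only corners stand between
    is first-order optimality of extreme points ([contact_bracket]). The length
    of the boundary of [K] enters through a primitive of its support function
    ([arclen]), and so does Cauchy's formula in the upper bound
    ([polygon_length_le]). That [X] is not empty while the inner parallel body
    of the Reuleaux triangle is not is Jung's inequality ([jung]), which is the
    lower bound applied at the circumradius of [K]. *)

(** * Euclidean plane geometry *)

Section Plane.
Context (R : realType).
Implicit Types (x y z p q : 'rV[R]_2) (a b c r s t : R).

Definition vec a b : 'rV[R]_2 := \row_j (if j == 0 then a else b).
Definition dir t := vec (cos t) (sin t).
Definition nor t := vec (- sin t) (cos t).

Lemma vec0 a b : vec a b 0 0 = a. Proof. by rewrite mxE. Qed.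
Lemma vec1 a b : vec a b 0 1 = b. Proof. by rewrite mxE. Qed.

Lemma row2P x y : x 0 0 = y 0 0 -> x 0 1 = y 0 1 -> x = y.
Proof.
move=> e0 e1; apply/rowP => -[[|[|//]] hj].
  by rewrite (_ : Ordinal hj = 0)//; exact/val_inj.
by rewrite (_ : Ordinal hj = 1)//; exact/val_inj.
Qed.

Lemma dotE x y : dot x y = x 0 0 * y 0 0 + x 0 1 * y 0 1.
Proof.
rewrite /dot !big_ord_recl big_ord0 addr0.
by have -> : lift ord0 ord0 = 1 :> 'I_2 by exact/val_inj.
Qed.

Lemma dotC x y : dot x y = dot y x. Proof. rewrite !dotE; ring. Qed.
Lemma dotDl x y z : dot (x + y) z = dot x z + dot y z.
Proof. rewrite !dotE !mxE; ring. Qed.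
Lemma dotNl x z : dot (- x) z = - dot x z.
Proof. rewrite !dotE !mxE; ring. Qed.
Lemma dotBl x y z : dot (x - y) z = dot x z - dot y z.
Proof. by rewrite dotDl dotNl. Qed.
Lemma dotZl a x z : dot (a *: x) z = a * dot x z.
Proof. rewrite !dotE !mxE; ring. Qed.
Lemma dotDr x y z : dot z (x + y) = dot z x + dot z y.
Proof. by rewrite dotC dotDl !(dotC z). Qed.
Lemma dotNr x z : dot z (- x) = - dot z x.
Proof. by rewrite dotC dotNl dotC. Qed.
Lemma dotBr x y z : dot z (x - y) = dot z x - dot z y.
Proof. by rewrite dotDr dotNr. Qed.
Lemma dotZr a x z : dot z (a *: x) = a * dot z x.
Proof. by rewrite dotC dotZl dotC. Qed.
Definition dot_lin := (dotDl, dotDr, dotNl, dotNr, dotZl, dotZr).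

Lemma dot0l x : dot 0 x = 0. Proof. rewrite dotE !mxE; ring. Qed.

Lemma dot_ge0 x : 0 <= dot x x.
Proof. rewrite dotE; nra. Qed.

Lemma dot_eq0 x : dot x x = 0 -> x = 0.
Proof. by rewrite dotE => h; apply: row2P; rewrite !mxE; nra. Qed.

Lemma enorm_ge0 x : 0 <= enorm x. Proof. exact: sqrtr_ge0. Qed.

Lemma enorm_sq x : enorm x ^+ 2 = dot x x.
Proof. by rewrite sqr_sqrtr ?dot_ge0. Qed.

Lemma enorm0 : enorm (0 : 'rV[R]_2) = 0.
Proof. by rewrite /enorm dot0l sqrtr0. Qed.

Lemma enorm_eq0 x : enorm x = 0 -> x = 0.
Proof. by move=> h; apply: dot_eq0; rewrite -enorm_sq h expr0n. Qed.

Lemma enormN x : enorm (- x) = enorm x.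
Proof. by rewrite /enorm dotNl dotNr opprK. Qed.

Lemma enorm_distC x y : enorm (x - y) = enorm (y - x).
Proof. by rewrite -enormN opprB. Qed.

Lemma enorm_le x r : 0 <= r -> (enorm x <= r) = (dot x x <= r ^+ 2).
Proof. by move=> r0; rewrite -enorm_sq ler_pXn2r ?nnegrE ?enorm_ge0. Qed.

Lemma enorm_ge x r : 0 <= r -> (r <= enorm x) = (r ^+ 2 <= dot x x).
Proof. by move=> r0; rewrite -enorm_sq ler_pXn2r ?nnegrE ?enorm_ge0. Qed.

Lemma enormZ a x : enorm (a *: x) = `|a| * enorm x.
Proof. by rewrite /enorm !dot_lin mulrA sqrtrM -?expr2 ?sqr_ge0// sqrtr_sqr. Qed.

Lemma cauchy_schwarz x y : dot x y <= enorm x * enorm y.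
Proof.
apply: le_trans (ler_norm _) _.
rewrite -(@ler_pXn2r _ 2) ?nnegrE ?mulr_ge0 ?enorm_ge0 ?normr_ge0//.
rewrite real_normK ?num_real// exprMn !enorm_sq !dotE -subr_ge0.
rewrite [leRHS](_ : _ = (x 0 0 * y 0 1 - x 0 1 * y 0 0) ^+ 2) ?sqr_ge0//; ring.
Qed.

Lemma enormD x y : enorm (x + y) <= enorm x + enorm y.
Proof.
rewrite enorm_le ?addr_ge0 ?enorm_ge0// !dot_lin (dotC y x).
have := cauchy_schwarz x y; rewrite -!enorm_sq; nra.
Qed.

Lemma enorm_triangle x y z : enorm (x - z) <= enorm (x - y) + enorm (y - z).
Proof. by rewrite (le_trans _ (enormD _ _))// addrA subrK. Qed.

(** ** The moving frame *)

Lemma dirDpi t : dir (t + pi) = - dir t.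
Proof. by apply: row2P; rewrite !mxE/= ?cosDpi ?sinDpi. Qed.

Lemma dirD2pi t : dir (t + pi *+ 2) = dir t.
Proof. by rewrite mulr2n addrA !dirDpi opprK. Qed.

Lemma norE t : nor t = dir (t + pi / 2).
Proof. by apply: row2P; rewrite !mxE/= ?cosDpihalf ?sinDpihalf. Qed.

Lemma norD2pi t : nor (t + pi *+ 2) = nor t.
Proof. by rewrite !norE addrAC dirD2pi. Qed.

Lemma norDpi t : nor (t + pi) = - nor t.
Proof. by rewrite !norE addrAC dirDpi. Qed.

Lemma dot_dir a b : dot (dir a) (dir b) = cos (a - b).
Proof. by rewrite dotE !mxE/= cosB. Qed.
Lemma dot_dirnor a b : dot (dir a) (nor b) = sin (a - b).
Proof. by rewrite dotE !mxE/= sinB; ring. Qed.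
Lemma dot_nordir a b : dot (nor a) (dir b) = - sin (a - b).
Proof. by rewrite dotC dot_dirnor -sinN opprB. Qed.
Lemma dot_nor a b : dot (nor a) (nor b) = cos (a - b).
Proof. by rewrite !norE dot_dir opprD addrACA subrr addr0. Qed.

Lemma enorm_dir t : enorm (dir t) = 1.
Proof. by rewrite /enorm dot_dir subrr cos0 sqrtr1. Qed.

Lemma enorm_nor t : enorm (nor t) = 1.
Proof. by rewrite norE enorm_dir. Qed.

Lemma dot_dir_le x t : dot x (dir t) <= enorm x.
Proof. by have := cauchy_schwarz x (dir t); rewrite enorm_dir mulr1. Qed.

Lemma dot_nor_le x t : dot x (nor t) <= enorm x.
Proof. by rewrite norE dot_dir_le. Qed.

Lemma dir_neq0 t : dir t != 0.
Proof.
by apply/eqP => h; have := enorm_dir t; rewrite h enorm0 => /eqP; rewrite eq_sym oner_eq0.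
Qed.

Lemma polar0 x : exists2 t, 0 <= t < pi *+ 2 & x = enorm x *: dir t.
Proof.
have [e0|n0] := eqVneq (enorm x) 0.
  exists 0; first by rewrite lexx pmulrn_lgt0 ?pi_gt0.
  by rewrite e0 scale0r; exact: enorm_eq0.
have n1 : 0 < enorm x by rewrite lt_def n0 enorm_ge0.
set c := x 0 0 / enorm x; set d := x 0 1 / enorm x.
have cd : c ^+ 2 + d ^+ 2 = 1.
  have e2 : x 0 0 ^+ 2 + x 0 1 ^+ 2 = enorm x ^+ 2 by rewrite enorm_sq dotE !expr2.
  by rewrite /c /d !exprMn -mulrDl e2 exprVn divff// expf_neq0.
have c1 : -1 <= c <= 1 by apply/andP; split; nra.
have e0 : x 0 0 = enorm x * c by rewrite /c mulrCA divff ?mulr1.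
have e1 : x 0 1 = enorm x * d by rewrite /d mulrCA divff ?mulr1.
have [d0|d0] := leP 0 d.
  exists (acos c); first by rewrite acos_ge0// (le_lt_trans (acos_lepi c1))// mulr2n ltrDl pi_gt0.
  apply: row2P; rewrite !mxE/= ?acosK ?in_itv//= sin_acos//.
  have -> : 1 - c ^+ 2 = d ^+ 2 by lra.
  by rewrite sqrtr_sqr ger0_norm.
exists (pi *+ 2 - acos c).
  have := acos_lepi c1; have := pi_gt0 R; have: 0 < acos c.
    rewrite acos_gt0//; apply/andP; split; nra.
  by move=> *; apply/andP; split; lra.
apply: row2P; rewrite !mxE/= addrC ?cosD2pi ?sinD2pi ?cosN ?sinN.
  by rewrite acosK ?in_itv.
rewrite sin_acos//.
have -> : 1 - c ^+ 2 = d ^+ 2 by lra.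
by rewrite sqrtr_sqr ltr0_norm// opprK.
Qed.

Lemma rotate_dir x a r t :
  vec (dot x (dir a)) (dot x (nor a)) = r *: dir t -> x = r *: dir (t + a).
Proof.
move=> /rowP h; have := h 0; have := h 1; rewrite !mxE/= !dotE !mxE/= => h1 h0.
have cs := cos2Dsin2 a.
apply: row2P; rewrite !mxE/= ?cosD ?sinD.
  have -> : r * (cos t * cos a - sin t * sin a) = (r * cos t) * cos a - (r * sin t) * sin a by ring.
  by rewrite -h0 -h1; transitivity (x 0 0 * (cos a ^+ 2 + sin a ^+ 2)); [rewrite cs mulr1|ring].
have -> : r * (sin t * cos a + cos t * sin a) = (r * sin t) * cos a + (r * cos t) * sin a by ring.
by rewrite -h0 -h1; transitivity (x 0 1 * (cos a ^+ 2 + sin a ^+ 2)); [rewrite cs mulr1|ring].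
Qed.

Lemma polar x a : exists2 t, a <= t < a + pi *+ 2 & x = enorm x *: dir t.
Proof.
have [t t0 e] := polar0 (vec (dot x (dir a)) (dot x (nor a))).
have en : enorm (vec (dot x (dir a)) (dot x (nor a))) = enorm x.
  rewrite /enorm; congr Num.sqrt; rewrite !dotE !mxE/=.
  have cs := cos2Dsin2 a.
  transitivity ((x 0 0 ^+ 2 + x 0 1 ^+ 2) * (cos a ^+ 2 + sin a ^+ 2)); first ring.
  by rewrite cs mulr1 !expr2.
exists (t + a); first by apply/andP; split; lra.
by apply: rotate_dir; rewrite -en.
Qed.

Lemma polar_nor x a : exists2 t, a <= t < a + pi *+ 2 & x = enorm x *: nor t.
Proof.
have [t ta e] := polar x (a + pi / 2); exists (t - pi / 2); first lra.
by rewrite norE subrK.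
Qed.

End Plane.

(** * Calculus on the line *)

Section Calculus.
Context (R : realType).
Implicit Types (a b s t x y : R) (f g F G : R -> R).

(** A transparent copy of [is_derive] that is not a type class, so that no
    derivative is inferred behind the scenes. *)
Definition deriv_at f t d : Prop := is_derive t 1 f d.

(** Monotonicity of the integral, for integrands given by primitives. *)
Lemma increment_le F G f g a b : a <= b ->
  (forall t, a <= t <= b -> deriv_at F t (f t)) ->
  (forall t, a <= t <= b -> deriv_at G t (g t)) ->
  (forall t, a <= t <= b -> f t <= g t) ->
  F b - F a <= G b - G a.
Proof.
move=> ab dF dG fg.
have dH t : a <= t <= b -> is_derive t 1 (G \- F) (g t - f t).
  by move=> tab; apply: is_deriveB; [exact: dG|exact: dF].
have [||c cab /= e] := @MVT_segment R (G \- F) (fun t => g t - f t) a b ab.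
- move=> t; rewrite in_itv/= => /andP[at_ tb]; apply: dH; lra.
- apply: derivable_within_continuous => t; rewrite in_itv/= => /dH h.
  exact: ex_derive.
have : 0 <= (g c - f c) * (b - a).
  by rewrite mulr_ge0 ?subr_ge0// fg//; move: cab; rewrite in_itv.
lra.
Qed.

Lemma deriv_cast f t e : (exists2 d, deriv_at f t d & d = e) -> deriv_at f t e.
Proof. by move=> [d ? <-]. Qed.
Lemma deriv_const (k t : R) : deriv_at (fun _ : R => k) t 0.
Proof. exact: is_derive_cst. Qed.
Lemma deriv_id t : deriv_at (fun u : R => u) t 1.
Proof. exact: is_derive_id. Qed.
Lemma deriv_add f g t d e : deriv_at f t d -> deriv_at g t e ->
  deriv_at (fun u => f u + g u) t (d + e).
Proof. by move=> df dg; exact: is_deriveD. Qed.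
Lemma deriv_opp f t d : deriv_at f t d -> deriv_at (fun u => - f u) t (- d).
Proof. by move=> df; exact: is_deriveN. Qed.
Lemma deriv_mul f g t d e : deriv_at f t d -> deriv_at g t e ->
  deriv_at (fun u => f u * g u) t (f t * e + g t * d).
Proof. by move=> df dg; exact: is_deriveM. Qed.
Lemma deriv_sin f t d : deriv_at f t d ->
  deriv_at (fun u => sin (f u)) t (cos (f t) * d).
Proof. by move=> df; exact: is_derive1_comp. Qed.
Lemma deriv_cos f t d : deriv_at f t d ->
  deriv_at (fun u => cos (f u)) t (- sin (f t) * d).
Proof. by move=> df; exact: is_derive1_comp. Qed.

End Calculus.

Ltac compute_derivative :=
  intros; apply: deriv_cast; eexists;
  [repeat first [apply: deriv_const | apply: deriv_id
   | apply: deriv_mul | apply: deriv_add | apply: deriv_opp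
   | apply: deriv_sin | apply: deriv_cos | eassumption] | cbv beta; first [ring | by field]].

Section Trigonometry.
Context (R : realType).
Implicit Types (a b s t x y : R).

Lemma deriv_dot_nor (q : 'rV[R]_2) t :
  deriv_at (fun u => - dot q (nor u)) t (dot q (dir t)).
Proof.
rewrite (_ : (fun _ => _) = (fun u => q 0 0 * sin u + - (q 0 1 * cos u))).
  by rewrite dotE vec0 vec1; compute_derivative.
by apply/funext => u; rewrite dotE vec0 vec1; ring.
Qed.

Lemma sin_le_scale s x : 0 <= s <= 1 -> 0 <= x <= pi -> s * sin x <= sin (s * x).
Proof.
move=> s01 x0.
have := @increment_le R (fun t => s * sin t) (fun t => sin (s * t))
  (fun t => s * cos t) (fun t => s * cos (s * t)) 0 x.
rewrite mulr0 sin0 mulr0 !subr0; apply; first lra.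
- compute_derivative.
- compute_derivative.
- move=> t t0; apply: ler_wpM2l; first lra.
  have [->|ts] := eqVneq (s * t) t; first exact: lexx.
  have : s * t <= t by nra.
  by rewrite le_eqVlt (negbTE ts)/= => st; rewrite ltW// ltr_cos ?in_itv/=; nra.
Qed.

Lemma sin_sub_le x y : x <= y -> sin y - sin x <= y - x.
Proof.
move=> xy; apply: (@increment_le R sin id cos (fun=> 1)); first exact: xy.
- by move=> t _; exact: is_derive_sin.
- by move=> t _; exact: is_derive_id.
- by move=> t _; exact: cos_le1.
Qed.

Lemma cos_ge_linear x : 0 <= x -> 1 - x <= cos x.
Proof.
move=> x0.
have h : - cos x - - cos 0 <= x - 0 :> R.
  apply: (@increment_le R (fun u => - cos u) (fun u => u) sin (fun=> 1)); first exact: x0.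
  - compute_derivative.
  - compute_derivative.
  - by move=> *; exact: sin_le1.
by rewrite cos0 in h; lra.
Qed.

Lemma sin_ge_quadratic x : 0 <= x -> x - x * x / 2 <= sin x.
Proof.
move=> x0.
have := @increment_le R (fun u => u - u * u / 2) sin (fun u => 1 - u) cos 0 x x0.
rewrite sin0 !(mul0r,subr0); apply.
- compute_derivative.
- by move=> *; exact: is_derive_sin.
- by move=> t t0; apply: cos_ge_linear; lra.
Qed.

Lemma sin_pi6 : sin (pi / 6) = 1 / 2 :> R.
Proof.
have p0 := pi_gt0 R.
have c0 : cos (pi / 6) != 0 :> R by rewrite gt_eqF// cos_gt0_pihalf//; lra.
have e : sin (pi / 6 + pi / 6) = cos (pi / 6) :> R.
  rewrite -cosBpihalf -(cosN (pi / 6)); congr cos; by field.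
move: e; rewrite sinD => e; apply: (mulIf c0); lra.
Qed.

End Trigonometry.

Section Comparison.
Context (R : realType).
Implicit Types (a b s t x y : R) (f g h F G : R -> R).

Lemma increment_lt F G f g a b : a < b ->
  (forall t, a <= t <= b -> deriv_at F t (f t)) ->
  (forall t, a <= t <= b -> deriv_at G t (g t)) ->
  (forall t, a < t < b -> f t < g t) ->
  F b - F a < G b - G a.
Proof.
move=> ab dF dG fg.
have dH t : a <= t <= b -> is_derive t 1 (G \- F) (g t - f t).
  by move=> tab; apply: is_deriveB; [exact: dG|exact: dF].
have [||c cab /= e] := @MVT R (G \- F) (fun t => g t - f t) a b ab.
- move=> t; rewrite in_itv/= => /andP[at_ tb]; apply: dH; lra.
- apply: derivable_within_continuous => t; rewrite in_itv/= => /dH h.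
  exact: ex_derive.
have : 0 < (g c - f c) * (b - a).
  by rewrite mulr_gt0 ?subr_gt0// fg//; move: cab; rewrite in_itv.
lra.
Qed.

Lemma deriv_inv f t d : f t != 0 -> deriv_at f t d ->
  deriv_at (fun u => (f u)^-1) t (- (f t * f t)^-1 * d).
Proof.
move=> ft df; have := @is_deriveV R f t d 1 ft df.
by rewrite /deriv_at /GRing.scale/= -expr2.
Qed.

Lemma lt_sin x y : - (pi / 2) <= x <= pi / 2 -> - (pi / 2) <= y <= pi / 2 ->
  (sin x < sin y) = (x < y).
Proof. by move=> hx hy; rewrite ltr_sin// in_itv. Qed.

(** The derivative of the quotient of [sin (l * t)] by [sin t] has the sign of
    [l * cos (l * t) * sin t - sin (l * t) * cos t], which vanishes at the
    origin and has derivative [(1 - l * l) * (sin (l * t) * sin t)]. *)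
Lemma sin_ratio_lt l x y : 0 < l < 1 -> 0 < x < y -> y <= pi / 2 ->
  sin (l * x) * sin y < sin (l * y) * sin x.
Proof.
move=> l01 xy ypi; have p0 := pi_gt0 R.
have spos t : 0 < t <= y -> 0 < sin t by move=> ty; rewrite sin_gt0_pi//; lra.
have slpos t : 0 < t <= y -> 0 < sin (l * t).
  by move=> ty; apply: sin_gt0_pi; nra.
have gpos t : 0 < t <= y -> 0 < l * cos (l * t) * sin t - sin (l * t) * cos t.
  move=> ty.
  have := @increment_lt (fun=> 0) (fun u => l * cos (l * u) * sin u - sin (l * u) * cos u)
    (fun=> 0) (fun u => (1 - l * l) * (sin (l * u) * sin u)) 0 t.
  rewrite !(mulr0, sin0, mul0r, subr0); apply; first lra.
  - compute_derivative.
  - compute_derivative.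
  - move=> u ut; rewrite !mulr_gt0 ?spos ?slpos//; nra.
have := @increment_lt (fun=> 0) (fun u => sin (l * u) * (sin u)^-1) (fun=> 0)
   (fun u => (l * cos (l * u) * sin u - sin (l * u) * cos u) * (sin u * sin u)^-1) x y.
have sx : sin x > 0 by rewrite spos//; lra.
have sy : sin y > 0 by rewrite spos//; lra.
rewrite subrr subr_gt0 => h; have {h} : sin (l * x) / sin x < sin (l * y) / sin y.
  apply: h; first lra.
  - compute_derivative.
  - move=> t txy; have st : sin t > 0 by rewrite spos//; lra.
    have dV : deriv_at (fun u => (sin u)^-1) t (- (sin t * sin t)^-1 * cos t).
      by apply: deriv_inv; [rewrite gt_eqF|exact: is_derive_sin].
    apply: deriv_cast; eexists.
      by apply: deriv_mul; [apply: deriv_sin; apply: deriv_mul; [apply: deriv_const|apply: deriv_id]|exact: dV].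
    by cbv beta; field; rewrite gt_eqF.
  - move=> t txy; rewrite mulr_gt0 ?invr_gt0 ?gpos ?mulr_gt0 ?spos//; lra.
by rewrite ltr_pdivrMr// mulrAC ltr_pdivlMr.
Qed.

(** Circular arcs of radii [1] and [s] over a common chord have half-angles [A]
    and [B] with [sin A = s * sin B]. The more curved arc profits more from a
    longer chord: [B / A] grows with it. *)
Lemma arc_ratio_lt s A B A0 B0 : 0 < s < 1 -> 0 < B < B0 -> B0 <= pi / 2 ->
  0 <= A <= pi / 2 -> 0 <= A0 <= pi / 2 ->
  sin A = s * sin B -> sin A0 = s * sin B0 -> A0 * B < A * B0.
Proof.
move=> s01 BB B0pi Api A0pi eA eA0; have p0 := pi_gt0 R.
have sB0 : sin B0 > 0 by rewrite sin_gt0_pi//; lra.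
have sB : sin B > 0 by rewrite sin_gt0_pi//; lra.
have A0B0 : A0 < B0 by rewrite -lt_sin ?eA0; [nra|lra|lra].
have A00 : 0 < A0.
  by rewrite -lt_sin ?sin0 ?eA0; [nra|lra|lra].
have l01 : 0 < A0 / B0 < 1.
  by rewrite divr_gt0 ?ltr_pdivrMr; lra.
have := @sin_ratio_lt (A0 / B0) B B0 l01 BB B0pi.
rewrite divfK ?gt_eqF//; last lra.
rewrite eA0 [ltRHS]mulrAC ltr_pM2r// -eA lt_sin; [|nra|lra].
rewrite mulrAC ltr_pdivrMr//; lra.
Qed.

Lemma sin_inj_pihalf x y : - (pi / 2) <= x <= pi / 2 -> - (pi / 2) <= y <= pi / 2 ->
  sin x = sin y -> x = y.
Proof. by move=> hx hy e; apply: sin_inj; rewrite ?in_itv. Qed.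

Lemma arc_ratio_le s A B A0 B0 : 0 < s <= 1 -> 0 <= B <= B0 -> B0 <= pi / 2 ->
  0 <= A <= pi / 2 -> 0 <= A0 <= pi / 2 ->
  sin A = s * sin B -> sin A0 = s * sin B0 -> A0 * B <= A * B0.
Proof.
move=> s01 BB B0pi Api A0pi eA eA0; have p0 := pi_gt0 R.
have [B_eq|B_neq] := eqVneq B B0.
  have -> : A = A0 by apply: sin_inj_pihalf; rewrite ?eA ?eA0 ?B_eq//; lra.
  by rewrite B_eq.
have [s1|s1] := eqVneq s 1.
  have -> : A = B by apply: sin_inj_pihalf; rewrite ?eA ?s1 ?mul1r//; lra.
  have -> : A0 = B0 by apply: sin_inj_pihalf; rewrite ?eA0 ?s1 ?mul1r//; lra.
  by rewrite mulrC.
have [B00|B00] := eqVneq B 0.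
  by rewrite B00 mulr0 mulr_ge0//; lra.
by apply/ltW/(arc_ratio_lt (s := s)) => //; rewrite !lt_def ?(eq_sym B0) ?(eq_sym 1) ?s1 ?B_neq ?B00/=; lra.
Qed.

Lemma primitive_right h a : continuous h ->
  exists H, forall t, a < t -> deriv_at H t (h t).
Proof.
move=> ch.
exists (fun x => (\int[@lebesgue_measure R]_(t in [set` `[a, x]]) h t)%R) => t at_.
have [||dF eF] := @continuous_FTC1_closed R h a t (t + 1) _ _ at_ (ch t).
- by rewrite ltrDl.
- apply: continuous_compact_integrable; first exact: segment_compact.
  exact: continuous_subspaceT.
by rewrite /deriv_at -eF derive1E; exact: derivableP.
Qed.

Lemma deriv_near f g t d : (\forall u \near t, f u = g u) ->
  deriv_at f t d -> deriv_at g t d.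
Proof.
by move=> fg; exact: near_eq_is_derive.
Qed.

(** The integral from a base point gives a primitive to its right only; the
    reflection of such a primitive covers the left, and the two agree up to a
    constant on an overlap. *)
Lemma primitive_exists h : continuous h ->
  exists H, forall t, deriv_at H t (h t).
Proof.
move=> ch; have [F dF] := primitive_right (-1) ch.
have ch' : continuous (fun t => h (- t)).
  by move=> t; apply: continuous_comp; [exact: opp_continuous|exact: ch].
have [G dG] := primitive_right (-1) ch'.
have dG' t : t < 1 -> deriv_at (fun u => - G (- u)) t (h t).
  move=> t1; have dGt : deriv_at G (- t) (h t).
    by have := dG (- t); rewrite opprK; apply; lra.
  rewrite -[h t]opprK; apply: deriv_opp.
  rewrite -[X in deriv_at _ _ X]mulrN1.
  apply: (@is_derive1_comp R G (fun u => - u) t (h t) (-1)) => //.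
pose C := F 0 + G 0.
have FG t : -1 < t < 1 -> F t = - G (- t) + C.
  move=> t1; rewrite /C.
  have le a b : -1 < a -> b < 1 -> a <= b -> F b - F a = - G (- b) - - G (- a).
    move=> a1 b1 ab; apply/eqP; rewrite eq_le; apply/andP; split.
      apply: (@increment_le _ F (fun u => - G (- u)) h h) => // u uab;
        [apply: dF; lra|apply: dG'; lra].
    apply: (@increment_le _ (fun u => - G (- u)) F h h) => // u uab;
        [apply: dG'; lra|apply: dF; lra].
  have [t0|t0] := leP 0 t.
    by have := le 0 t; rewrite oppr0 => h'; have {h'} := h' _ _ t0; lra.
  by have := le t 0; rewrite oppr0 => h'; have {h'} := h' _ _ (ltW t0); lra.
exists (fun t => if t < 0 then - G (- t) + C else F t) => t.
have [t0|t0] := ltP t 0.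
  apply: (@deriv_near (fun u => - G (- u) + C)).
    near=> u; rewrite ifT//; near: u; exact: lt_nbhsl.
  by rewrite -[h t]addr0; apply: deriv_add; [apply: dG'; lra|exact: deriv_const].
apply: (@deriv_near F); last by apply: dF; lra.
near=> u; case: ltP => // u0; rewrite FG//; apply/andP; split; last lra.
near: u; apply: lt_nbhsr; lra.
Unshelve. all: by end_near. Qed.

End Comparison.

(** * Compact plane sets and their support functions *)

Section Topology.
Context (R : realType).
Implicit Types (x y z p q : 'rV[R]_2) (K : set 'rV[R]_2) (e t : R).

Lemma continuous_addf (T : topologicalType) (f g : T -> R) :
  continuous f -> continuous g -> continuous (fun u => f u + g u).
Proof. by move=> cf cg u; exact: (@continuousD R _ _ f g u (cf u) (cg u)). Qed.

Lemma continuous_mulf (T : topologicalType) (f g : T -> R) :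
  continuous f -> continuous g -> continuous (fun u => f u * g u).
Proof. by move=> cf cg u; exact: (@continuousM R _ f g u (cf u) (cg u)). Qed.

Lemma dot_continuous q : continuous (fun x => dot x q).
Proof.
rewrite (_ : (fun _ => _) = (fun y => y 0 0 * q 0 0 + y 0 1 * q 0 1)).
  by apply: continuous_addf; apply: continuous_mulf;
    (exact: coord_continuous || exact: cst_continuous).
by apply/funext => y; rewrite dotE.
Qed.

Lemma dist2_continuous q : continuous (fun x => dot (x - q) (x - q)).
Proof.
pose c i := fun x : 'rV[R]_2 => x 0 i + - q 0 i.
have cc i : continuous (c i).
  by apply: continuous_addf; [exact: coord_continuous|exact: cst_continuous].
rewrite (_ : (fun _ => _) = (fun y => c 0 y * c 0 y + c 1 y * c 1 y)).
  by apply: continuous_addf; apply: continuous_mulf; exact: cc.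
by apply/funext => y; rewrite dotE !mxE.
Qed.

Lemma compact_argmax K (f : 'rV[R]_2 -> R) : K !=set0 -> compact K ->
  continuous f -> exists2 x, K x & forall y, K y -> f y <= f x.
Proof.
move=> K0 cK cf.
have [x xK h] := compact_EVT_max K0 cK (continuous_subspaceT cf).
by exists x => [|y yK]; [exact: set_mem|apply: h; exact: mem_set].
Qed.

Lemma compact_argmin K (f : 'rV[R]_2 -> R) : K !=set0 -> compact K ->
  continuous f -> exists2 x, K x & forall y, K y -> f x <= f y.
Proof.
move=> K0 cK cf.
have [x xK h] := compact_EVT_min K0 cK (continuous_subspaceT cf).
by exists x => [|y yK]; [exact: set_mem|apply: h; exact: mem_set].
Qed.

Lemma coord_enorm x i : `|x 0 i| <= enorm x.
Proof.
rewrite enorm_ge ?normr_ge0// real_normK ?num_real// dotE.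
have [->|->] : i = 0 \/ i = 1; last 2 first.
- by rewrite expr2; nra.
- by rewrite expr2; nra.
by case: i => [[|[|//]] hi]; [left|right]; exact/val_inj.
Qed.

Lemma enorm_le_coord x : enorm x <= `|x 0 0| + `|x 0 1|.
Proof.
rewrite enorm_le ?addr_ge0// dotE -[x 0 0 * _]expr2 -[x 0 1 * _]expr2.
rewrite -[x 0 0 ^+ 2]real_normK ?num_real// -[x 0 1 ^+ 2]real_normK ?num_real//.
have := normr_ge0 (x 0 0); have := normr_ge0 (x 0 1); nra.
Qed.

Lemma interior_diskP K x :
  interior K x <-> exists2 e, 0 < e & disk x e `<=` K.
Proof.
split=> [/nbhs_ballP[e /= e0 eK]|[e e0 eK]].
  exists (e / 2) => [|y yx]; first by rewrite divr_gt0.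
  apply: eK; split=> // i j; rewrite /ball/= (ord1 i).
  have := coord_enorm (y - x) j; rewrite !mxE distrC => h.
  by apply: le_lt_trans h _; apply: le_lt_trans yx _; lra.
apply/nbhs_ballP; exists (e / 2) => /=; first by rewrite divr_gt0.
move=> y yx; apply: eK; rewrite /disk/=; apply: le_trans (enorm_le_coord _) _.
have h i : `|(y - x) 0 i| < e / 2 by have := yx.2 0 i; rewrite /ball/= distrC !mxE.
by have := h 0; have := h 1; lra.
Qed.

Lemma compact_plane_closed K : compact K -> closed K.
Proof. by apply: compact_closed; exact: norm_hausdorff. Qed.

Lemma bdry_compact_sub K x : compact K -> bdry K x -> K x.
Proof. by move=> /compact_plane_closed/closure_id {2}-> []. Qed.

Lemma compact_bound K : compact K -> exists2 M, 0 < M & forall x, K x -> enorm x <= M.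
Proof.
move=> cK; have [->|K0] := eqVneq K set0; first by exists 1.
have /set0P K0' := K0.
have [x Kx h] := compact_argmax K0' cK (@dist2_continuous 0).
exists (enorm x + 1) => [|y Ky]; first by have := enorm_ge0 x; lra.
have := h y Ky; rewrite !subr0 -!enorm_sq.
have := enorm_ge0 x; have := enorm_ge0 y; nra.
Qed.

Lemma norm_sin_sub (a b : R) : `|sin a - sin b| <= `|a - b|.
Proof.
wlog ab : a b / b <= a.
  move=> h; have [/h//|/ltW/h] := leP b a.
  by rewrite distrC (distrC a).
rewrite [leRHS]ger0_norm ?subr_ge0// ler_norml sin_sub_le// andbT.
have /sin_sub_le : b + pi <= a + pi by rewrite lerD2r.
by rewrite !sinDpi; lra.
Qed.

Lemma norm_cos_sub (a b : R) : `|cos a - cos b| <= `|a - b|.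
Proof.
rewrite -!sinDpihalf (le_trans (norm_sin_sub _ _))//.
by rewrite opprD addrACA subrr addr0.
Qed.

Lemma lipschitz_continuous1 (f : R -> R) (k : R) :
  (forall s t, f s - f t <= k * `|s - t|) -> continuous f.
Proof.
move=> hk t; apply/cvgrPdist_le => /= e e0.
have k1 : 0 < `|k| + 1 by have := normr_ge0 k; lra.
near=> s.
have st : `|t - s| <= e / (`|k| + 1).
  near: s; apply: cvgr_dist_le; [exact: cvg_id|by rewrite divr_gt0].
have kk : k * `|t - s| <= e.
  move: st; rewrite ler_pdivlMr// => st.
  have := ler_norm k; have := normr_ge0 (t - s); nra.
rewrite ler_norml; have := hk t s; have := hk s t; rewrite (distrC s).
by lra.
Unshelve. all: by end_near. Qed.

Definition supportfun K t : R := sup [set dot x (dir t) | x in K].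

Section Support.
Variables (K : set 'rV[R]_2) (K0 : K !=set0) (cK : compact K).

Lemma support_attained t : exists2 x, K x & supportfun K t = dot x (dir t).
Proof.
have [x Kx h] := compact_argmax K0 cK (@dot_continuous (dir t)).
exists x => //; apply/eqP; rewrite eq_le; apply/andP; split.
  by apply: ge_sup; [exists (dot x (dir t)), x|move=> _ [y Ky <-]; exact: h].
apply: ub_le_sup; last by exists x.
by exists (dot x (dir t)) => _ [y Ky <-]; exact: h.
Qed.

Lemma support_ge x t : K x -> dot x (dir t) <= supportfun K t.
Proof.
move=> Kx; apply: ub_le_sup; last by exists x.
have [y Ky h] := compact_argmax K0 cK (@dot_continuous (dir t)).
by exists (dot y (dir t)) => _ [z Kz <-]; exact: h.
Qed.

Lemma support_continuous : continuous (supportfun K).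
Proof.
have [M M0 hM] := compact_bound cK.
apply: (@lipschitz_continuous1 _ (M * 2)) => s t.
have [x Kx ->] := support_attained s; have := support_ge t Kx.
suff : dot x (dir s) - dot x (dir t) <= M * 2 * `|s - t| by lra.
rewrite -dotBr (le_trans (cauchy_schwarz _ _))// -mulrA.
apply: ler_pM; rewrite ?enorm_ge0 ?hM//.
rewrite (le_trans (enorm_le_coord _))// !mxE/=.
by have := norm_sin_sub s t; have := norm_cos_sub s t; lra.
Qed.

Lemma supportD2pi t : supportfun K (t + pi *+ 2) = supportfun K t.
Proof. by rewrite /supportfun dirD2pi. Qed.

End Support.

End Topology.

(** * Bodies of constant width *)

Section Width.
Context (R : realType).
Implicit Types (x y z p q u v : 'rV[R]_2) (K : set 'rV[R]_2) (s t : R).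

(** For a body [K] of constant width [1] and [s = 1 - t], this is the inner
    parallel body at distance [t]. *)
Definition ball_dual K s : set 'rV[R]_2 :=
  [set x | forall p, K p -> enorm (x - p) <= s].

(** That [K] is its own [ball_dual] of radius [1] says at once that the diameter
    is at most [1] and that no point can be added without enlarging it. *)
Definition width_one K := [/\ K !=set0, compact K,
  forall x, K x <-> ball_dual K 1 x &
  forall t, supportfun K t + supportfun K (t + pi) = 1].

Lemma convex_comb K x y l : convex_set K -> K x -> K y -> 0 <= l <= 1 ->
  K (l *: x + (1 - l) *: y).
Proof.
move=> cK Kx Ky /andP[l0 l1].
by have := cK x y (Itv01 l0 l1) (mem_set Kx) (mem_set Ky) => /set_mem.
Qed.

Lemma frame_decomp x t : x = dot x (dir t) *: dir t + dot x (nor t) *: nor t.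
Proof.
have cs := cos2Dsin2 t.
apply: row2P; rewrite !mxE/= !dotE !mxE/=.
  by transitivity (x 0 0 * (cos t ^+ 2 + sin t ^+ 2)); [rewrite cs mulr1|ring].
by transitivity (x 0 1 * (cos t ^+ 2 + sin t ^+ 2)); [rewrite cs mulr1|ring].
Qed.

Lemma set_dist_line t (a b : R) : a <= b ->
  set_dist (line (dir t) a) (line (dir t) b) = b - a.
Proof.
move=> ab; rewrite /set_dist.
set S := [set _ | _].
have dd : dot (dir t) (dir t) = 1 :> R by rewrite dot_dir subrr cos0.
have Sba : S (b - a).
  exists (a *: dir t), (b *: dir t); split; rewrite ?/line/= ?dotZr ?dd ?mulr1//.
  by rewrite enorm_distC -scalerBl enormZ enorm_dir mulr1 ger0_norm ?subr_ge0.
have lb : lbound S (b - a).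
  move=> _ [x [y [<- <- ->]]]; rewrite enorm_distC !(dotC (dir t)) -dotBl.
  exact: dot_dir_le.
apply/eqP; rewrite eq_le; apply/andP; split; last by apply: lb_le_inf => //; exists (b - a).
by apply: ge_inf => //; exists (b - a).
Qed.

Lemma supporting_support K t : K !=set0 -> compact K ->
  supporting_line K (dir t) (supportfun K t).
Proof.
move=> K0 cK; split; first exact: dir_neq0.
  by have [x Kx e] := support_attained K0 cK t; exists x; split=> //=; rewrite /line/= dotC.
move=> x y Kx Ky; rewrite /separates !(dotC (dir t)).
by have := support_ge K0 cK t Kx; have := support_ge K0 cK t Ky; lra.
Qed.

Lemma support_opp K t : K !=set0 -> compact K -> forall x, K x ->
  - supportfun K (t + pi) <= dot x (dir t).
Proof.
move=> K0 cK x Kx; have := support_ge K0 cK (t + pi) Kx.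
by rewrite dirDpi dotNr; lra.
Qed.

Lemma constant_width_support K : K !=set0 -> compact K -> constant_width K 1 ->
  forall t, supportfun K t + supportfun K (t + pi) = 1.
Proof.
move=> K0 cK cw t.
have [x Kx] := K0.
have le : - supportfun K (t + pi) <= supportfun K t.
  exact: le_trans (support_opp t K0 cK Kx) (support_ge K0 cK t Kx).
have := cw (dir t) (- supportfun K (t + pi)) (supportfun K t).
rewrite set_dist_line// opprK => <- //.
- split; first exact: dir_neq0.
    have [y Ky e] := support_attained K0 cK (t + pi); exists y; split=> //=.
    by rewrite /line/= dotC e dirDpi dotNr opprK.
  move=> y z Ky Kz; rewrite /separates !(dotC (dir t)).
  by have := support_opp t K0 cK Ky; have := support_opp t K0 cK Kz; lra.
- exact: supporting_support.
- by move=> y Ky; rewrite dotC support_opp// support_ge.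
Qed.

(** The point of [K] nearest to an outer point [x] supports [K] in the
    direction of [x]; the opposite supporting point is one unit further off. *)
Lemma constant_width_one K : compact_convex K -> constant_width K 1 -> width_one K.
Proof.
move=> [K0 cK vK] cw; have hw := constant_width_support K0 cK cw.
split=> // x; split=> [Kx p Kp|hx].
  have [t _ e] := polar (x - p) 0.
  have := support_ge K0 cK t Kx; have := support_opp t K0 cK Kp.
  have ed : dot (x - p) (dir t) = enorm (x - p).
    by rewrite {1}e dotZl dot_dir subrr cos0 mulr1.
  by have := hw t; rewrite -ed dotBl; lra.
have [z Kz hz] := compact_argmin K0 cK (@dist2_continuous _ x).
have [t _ e] := polar (x - z) 0.
set d := enorm (x - z) in e.
have [d0|dn0] := eqVneq d 0.
  by move: e; rewrite d0 scale0r => /eqP; rewrite subr_eq0 => /eqP ->.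
have d1 : 0 < d by rewrite lt_def dn0 enorm_ge0.
have obtuse p : K p -> dot (p - z) (dir t) <= 0.
  move=> Kp; rewrite leNgt; apply/negP => c0.
  set c := dot (p - z) (dir t) in c0; set m := dot (p - z) (p - z).
  have m0 : 0 <= m := dot_ge0 _.
  pose l := d * c / (d * c + m).
  have dc : 0 < d * c by rewrite mulr_gt0.
  have dcm : 0 < d * c + m by lra.
  have l0 : 0 < l by apply: divr_gt0.
  have l1 : l <= 1 by rewrite /l ler_pdivrMr// mul1r lerDl.
  have lm : l * m <= d * c by rewrite /l mulrAC ler_pdivrMr//; nra.
  have l01 : 0 <= l <= 1 by rewrite ltW.
  have := hz _ (convex_comb vK Kp Kz l01).
  have -> : l *: p + (1 - l) *: z - x = l *: (p - z) - d *: dir t.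
    rewrite -e scalerBl scale1r scalerBr; apply: row2P; rewrite !mxE; ring.
  have -> : z - x = - (d *: dir t) by rewrite -e opprB.
  have sqE (k : R) w : dot (k *: w - d *: dir t) (k *: w - d *: dir t) =
      k * k * dot w w - 2 * k * (d * dot w (dir t)) + d * d.
    by rewrite !dot_lin (dotC (dir t) w) dot_dir subrr cos0; ring.
  have dd : dot (- (d *: dir t)) (- (d *: dir t)) = d * d.
    by rewrite !dot_lin dot_dir subrr cos0; ring.
  rewrite sqE dd -/c -/m; nra.
have sz : supportfun K t = dot z (dir t).
  have [p Kp ep] := support_attained K0 cK t.
  apply/eqP; rewrite eq_le support_ge// andbT ep.
  by have := obtuse p Kp; rewrite dotBl; lra.
have [p Kp ep] := support_attained K0 cK (t + pi).
have xz : dot (x - z) (dir t) = d by rewrite e dotZl dot_dir subrr cos0 mulr1.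
have := hx p Kp; have := dot_dir_le (x - p) t.
have := hw t; move: xz; rewrite sz ep dirDpi dotNr !dotBl; lra.
Qed.

(** The ray leaving [p] through [x] meets the boundary of [K] before it leaves
    the disk of radius [1] about [p]. *)
Lemma bdry_on_ray K p x : compact K -> K `<=` disk p 1 -> K x ->
  exists2 z, bdry K z & enorm (x - z) <= 1 - enorm (x - p).
Proof.
move=> cK Kp Kx; have [t _ e] := polar (x - p) 0.
pose S := K `&` ((fun z => dot z (nor t)) @^-1` [set dot x (nor t)] `&`
  (fun z => dot z (dir t)) @^-1` [set r | dot x (dir t) <= r]).
have cS : compact S.
  apply: compact_closedI => //; apply: closedI; apply: preimage_closed.
  - by move=> z _; exact: dot_continuous.
  - exact: closed_eq.
  - by move=> z _; exact: dot_continuous.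
  - exact: closed_ge.
have S0 : S !=set0 by exists x; split=> //; split=> /=.
have [z [Kz [/= zn zd]] hz] := compact_argmax S0 cS (@dot_continuous _ (dir t)).
set k := dot z (dir t) - dot x (dir t).
have k0 : 0 <= k by rewrite subr_ge0.
have zx : z = x + k *: dir t.
  have := frame_decomp (z - x) t; rewrite !dotBl zn subrr scale0r addr0 -/k => <-.
  by rewrite addrC subrK.
clearbody k; exists z.
  split; first exact: subset_closure.
  move=> /interior_diskP[r r0 rK].
  have Kzr : K (z + r *: dir t).
    by apply: rK; rewrite /disk/= addrC addKr enormZ enorm_dir mulr1 ger0_norm// ltW.
  have := hz (z + r *: dir t); rewrite dotDl dotZl dot_dir subrr cos0 mulr1.
  suff h : S (z + r *: dir t) by move=> /(_ h); lra.
  split=> //; split=> /=.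
    by rewrite dotDl dotZl dot_dirnor subrr sin0 mulr0 addr0.
  by rewrite dotDl dotZl dot_dir subrr cos0 mulr1; lra.
have := Kp z Kz; rewrite /disk/= zx.
have -> : x + k *: dir t - p = (enorm (x - p) + k) *: dir t.
  by rewrite scalerDl -e addrAC.
rewrite enormZ enorm_dir mulr1 ger0_norm; last by rewrite addr_ge0// enorm_ge0.
rewrite opprD addrA subrr add0r enormN enormZ enorm_dir mulr1 ger0_norm//; lra.
Qed.

Lemma inner_parallel_le K p t x : compact K -> K `<=` disk p 1 ->
  inner_parallel K t x -> enorm (x - p) <= 1 - t.
Proof.
move=> cK Kp [Kx]; have [z bz hz] := bdry_on_ray cK Kp Kx.
move=> /le_trans/(_ (_ : _ <= enorm (x - z))) h.
suff : t <= enorm (x - z) by lra.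
apply: h; apply: ge_inf; last by exists x, z.
by exists 0 => _ [? [? [_ _ ->]]]; exact: enorm_ge0.
Qed.

(** A disk about [x] lies in [K] as soon as it lies in all unit disks about
    points of [K], because [K] is the intersection of these. *)
Lemma inner_parallel_dual K t : width_one K -> 0 <= t ->
  inner_parallel K t = ball_dual K (1 - t).
Proof.
move=> [K0 cK dK _] t0; apply/seteqP; split=> x.
  move=> hx p Kp; apply: inner_parallel_le hx => // y Ky.
  by apply dK in Ky; exact: Ky.
move=> hx; have Kx : K x by apply/dK => p Kp; have := hx p Kp; lra.
split=> //; have [p Kp] := K0.
have Kp1 : K `<=` disk p 1 by move=> y /dK; exact.
have [z bz _] := bdry_on_ray cK Kp1 Kx.
apply: lb_le_inf; first by exists (enorm (x - z)), x, z.
move=> _ [_ [y [-> [_ iy] ->]]].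
rewrite leNgt; apply/negP => ylt; apply: iy; apply/interior_diskP.
exists (t - enorm (x - y)); first by rewrite subr_gt0.
move=> w hw; apply/dK => q Kq; have := hx q Kq.
have := enorm_triangle w x q; have := enorm_triangle w y x.
by rewrite (enorm_distC y x); move: hw; rewrite /disk/=; lra.
Qed.

End Width.

(** * Extreme points of the inner parallel body *)

Section Cones.
Context (R : realType).
Implicit Types (x y z p q u v w : 'rV[R]_2) (a b s t : R).

Lemma cone_dir v a b t : a <= t <= b -> b < a + pi ->
  dot v (dir a) <= 0 -> dot v (dir b) <= 0 -> dot v (dir t) <= 0.
Proof.
move=> atb bpi va vb; have [ab|ab] := eqVneq a b.
  by have -> : t = a by lra.
have sab : 0 < sin (b - a).
  have : a < b by rewrite lt_neqAle ab; lra.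
  by move=> ?; rewrite sin_gt0_pi//; lra.
have e : sin (b - a) * dot v (dir t) =
    sin (b - t) * dot v (dir a) + sin (t - a) * dot v (dir b).
  by rewrite !dotE !mxE/= !sinB; ring.
have s1 : 0 <= sin (b - t) by rewrite sin_ge0_pi//; lra.
have s2 : 0 <= sin (t - a) by rewrite sin_ge0_pi//; lra.
by rewrite -(pmulr_rle0 _ sab) e; nra.
Qed.

(** Each disk lies in the half-plane that supports it at the common boundary
    point [w]; the inequality passes to the cone spanned by the two normals. *)
Lemma corner_extreme p q w x r a b t : 0 < r -> a <= t <= b -> b < a + pi ->
  w = p + r *: dir a -> w = q + r *: dir b ->
  enorm (x - p) <= r -> enorm (x - q) <= r -> dot (x - w) (dir t) <= 0.
Proof.
move=> r0 atb bpi wp wq xp xq.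
have half o c : w = o + r *: dir c -> enorm (x - o) <= r -> dot (x - w) (dir c) <= 0.
  move=> ->; rewrite opprD addrA => h; rewrite dotBl dotZl dot_dir subrr cos0 mulr1.
  by have := dot_dir_le (x - o) c; lra.
exact: cone_dir atb bpi (half _ _ wp xp) (half _ _ wq xq).
Qed.

Lemma cos_ge0_range (x : R) : - pi <= x <= pi -> 0 <= cos x -> - (pi / 2) <= x <= pi / 2.
Proof.
move=> xpi cx; have p0 := pi_gt0 R.
rewrite leNgt [X in _ && X]leNgt -negb_or; apply/negP => /orP[h|h].
  have : 0 < cos (x + pi) by rewrite cos_gt0_pihalf//; lra.
  by rewrite cosDpi; lra.
have : 0 < cos (x - pi) by rewrite cos_gt0_pihalf//; lra.
by have := cosDpi (x - pi); rewrite subrK; lra.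
Qed.

Lemma dir_continuous x s : continuous (fun t => x + s *: dir t).
Proof.
move=> t U /interior_diskP[e e0 eU].
have k0 : 0 < `|s| * 2 + 1 by have := normr_ge0 s; lra.
suff : \forall r \near t, U (x + s *: dir r) by [].
near=> r; apply: eU; rewrite /disk/=.
have -> : x + s *: dir r - (x + s *: dir t) = s *: (dir r - dir t).
  by apply: row2P; rewrite !mxE; ring.
rewrite enormZ.
have h : enorm (dir r - dir t) <= 2 * `|r - t|.
  rewrite (le_trans (enorm_le_coord _))// !mxE/=.
  by have := norm_sin_sub r t; have := norm_cos_sub r t; lra.
have rt : `|t - r| <= e / (`|s| * 2 + 1).
  by near: r; apply: cvgr_dist_le; [exact: cvg_id|rewrite divr_gt0].
move: rt; rewrite ler_pdivlMr// distrC => rt.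
have := normr_ge0 s; have := normr_ge0 (r - t); nra.
Unshelve. all: by end_near. Qed.

End Cones.

Section BallDual.
Context (R : realType).
Implicit Types (x y z p q u v w : 'rV[R]_2) (a b t : R).
Variables (K : set 'rV[R]_2) (s : R).
Hypotheses (hK : width_one K) (s01 : 0 < s <= 1).
Hypothesis X0 : ball_dual K s !=set0.
Let X := ball_dual K s.

Let K0 : K !=set0. Proof. by case: hK. Qed.
Let cK : compact K. Proof. by case: hK. Qed.
Let s0 : 0 < s. Proof. by case/andP: s01. Qed.
Let s0W : 0 <= s. Proof. exact: ltW. Qed.

Lemma ball_dual_compact : compact X.
Proof.
have XE : X = \bigcap_(p in K) ((fun x => dot (x - p) (x - p)) @^-1` [set r | r <= s ^+ 2]).
  by apply/seteqP; split=> x h p Kp; have := h p Kp; rewrite /= (enorm_le _ s0W).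
apply: subclosed_compact cK _.
  rewrite XE; apply: closed_bigI => p _; apply: preimage_closed.
    by move=> z _; exact: dist2_continuous.
  exact: closed_le.
by case: hK => _ _ hd _ x hx; apply/hd => p Kp; have := hx p Kp; have := s01; lra.
Qed.

(** By the parallelogram law the midpoint of [x] and [y] is closer to every
    point of [K] than [s], by an amount that depends on [x - y] only. *)
Lemma ball_dual_strict x y : X x -> X y -> x != y ->
  exists2 e, 0 < e & forall z, enorm (z - (2^-1 *: (x + y))) <= e -> X z.
Proof.
move=> Xx Xy xy.
set m := dot (x - y) (x - y) / 4.
have m0 : 0 < m.
  rewrite /m divr_gt0// lt_def dot_ge0 andbT.
  by apply: contra_neq xy => /dot_eq0/eqP; rewrite subr_eq0 => /eqP.
have mid p : K p -> dot (2^-1 *: (x + y) - p) (2^-1 *: (x + y) - p) <= s ^+ 2 - m.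
  move=> Kp; have := Xx p Kp; have := Xy p Kp; rewrite !(enorm_le _ s0W).
  have -> : dot (2^-1 *: (x + y) - p) (2^-1 *: (x + y) - p) =
      (dot (x - p) (x - p) + dot (y - p) (y - p)) / 2 - m.
    by rewrite /m !dotE !mxE; field.
  lra.
have ms : m <= s ^+ 2.
  have [p Kp] := K0; have := mid p Kp.
  by have := dot_ge0 (2^-1 *: (x + y) - p); lra.
exists (m / (2 * s)) => [|z hz p Kp]; first by rewrite divr_gt0// mulr_gt0.
set e := m / (2 * s) in hz.
have me : m = 2 * s * e by rewrite /e mulrC divfK// gt_eqF// mulr_gt0.
have : enorm (2^-1 *: (x + y) - p) <= s - e.
  rewrite enorm_le; first by have := mid p Kp; nra.
  by have := s0; nra.
have := enorm_triangle z (2^-1 *: (x + y)) p; lra.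
Qed.

Definition extreme_pt t : 'rV[R]_2 :=
  xget 0 [set x | X x /\ forall y, X y -> dot y (dir t) <= dot x (dir t)].
(** The centre of the disk of radius [s] that touches the line supporting the
    intersection at its extreme point. It can fail to belong to [K] only if
    the extreme point is a corner with [t] inside its normal cone. *)
Definition foot t := extreme_pt t - s *: dir t.
Definition touching t := K (foot t).

Lemma extreme_ptP t :
  X (extreme_pt t) /\ forall y, X y -> dot y (dir t) <= dot (extreme_pt t) (dir t).
Proof.
have [x Xx hx] := compact_argmax X0 ball_dual_compact (@dot_continuous _ (dir t)).
by rewrite /extreme_pt; case: xgetP => [y -> //|/(_ x)]; case.
Qed.

Lemma extreme_pt_in t : X (extreme_pt t). Proof. by case: (extreme_ptP t). Qed.

Lemma extreme_pt_uniq t x : X x ->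
  (forall y, X y -> dot y (dir t) <= dot x (dir t)) -> extreme_pt t = x.
Proof.
move=> Xx hx; have [Xe he] := extreme_ptP t; apply/eqP/negPn/negP => ne.
have [e e0 he'] := ball_dual_strict Xe Xx ne.
have : X (2^-1 *: (extreme_pt t + x) + e *: dir t).
  by apply: he'; rewrite addrC addKr enormZ enorm_dir mulr1 ger0_norm// ltW.
move=> Xm; have := he _ Xm; have := hx _ Xm.
by rewrite !dot_lin dot_dir subrr cos0; lra.
Qed.

Lemma extreme_pt_lt t x : X x -> x != extreme_pt t ->
  dot x (dir t) < dot (extreme_pt t) (dir t).
Proof.
move=> Xx ne; rewrite ltNge; apply: contra_neqN ne => le.
apply/esym/extreme_pt_uniq => // y Xy; apply: le_trans le.
by have [_] := extreme_ptP t; exact.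
Qed.

Lemma extreme_ptD2pi t : extreme_pt (t + pi *+ 2) = extreme_pt t.
Proof. by rewrite /extreme_pt dirD2pi. Qed.

Lemma footD2pi t : foot (t + pi *+ 2) = foot t.
Proof. by rewrite /foot extreme_ptD2pi dirD2pi. Qed.

Lemma extreme_pt_const a b t : a <= t <= b -> b <= a + pi ->
  extreme_pt a = extreme_pt b -> extreme_pt t = extreme_pt a.
Proof.
move=> atb bpi ab.
have hle c y : X y -> dot (y - extreme_pt c) (dir c) <= 0.
  by move=> Xy; have [_ h] := extreme_ptP c; have := h y Xy; rewrite dotBl; lra.
have [bpi'|bpi'] := eqVneq b (a + pi).
  (* Opposite directions share an extreme point only when X is that point. *)
  have Xe y : X y -> y = extreme_pt a.
    move=> Xy; apply/esym/extreme_pt_uniq => // z Xz.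
    have := hle b y Xy; have := hle a z Xz; rewrite -ab bpi' dirDpi dotNr !dotBl.
    lra.
  by apply: Xe; exact: extreme_pt_in.
apply: extreme_pt_uniq => [|y Xy]; first exact: extreme_pt_in.
suff : dot (y - extreme_pt a) (dir t) <= 0 by rewrite dotBl; lra.
apply: cone_dir atb _ (hle _ _ Xy) _.
  by rewrite lt_def eq_sym bpi'.
by rewrite ab; exact: hle.
Qed.

Lemma touch_extreme x t : X x -> K (x - s *: dir t) -> extreme_pt t = x.
Proof.
move=> Xx Kx; apply: extreme_pt_uniq => // y Xy.
have := Xy _ Kx; have := dot_dir_le (y - (x - s *: dir t)) t.
by rewrite !dot_lin dot_dir subrr cos0; lra.
Qed.

(** First-order optimality: otherwise a small step along [w] stays within
    distance [s] of all of [K] and increases the linear functional. *)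
Lemma active_halfplane x t w : X x ->
  (forall y, X y -> dot y (dir t) <= dot x (dir t)) -> 0 <= dot w (dir t) ->
  exists2 p, K p & enorm (x - p) = s /\ 0 <= dot (x - p) w.
Proof.
move=> Xx hx wt.
pose f p := dot (p - x) (p - x) - s ^+ 2; pose g p := dot x w - dot p w.
have cf : continuous f.
  by apply: continuous_addf; [exact: dist2_continuous|exact: cst_continuous].
have cg : continuous g.
  rewrite (_ : g = fun p => dot x w + dot p (- w)).
    by apply: continuous_addf; [exact: cst_continuous|exact: dot_continuous].
  by apply/funext => p; rewrite dotNr.
have cfg : continuous (fun p => Num.min (f p) (g p)).
  by move=> p; exact: (@continuous_min _ _ f g p (cf p) (cg p)).
have [p Kp hp] := compact_argmax K0 cK cfg.
have sq q : K q -> dot (q - x) (q - x) <= s ^+ 2.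
  by move=> Kq; rewrite -(enorm_le _ s0W) enorm_distC; exact: Xx.
have [m0|m0] := leP 0 (Num.min (f p) (g p)).
  move: m0; rewrite le_min => /andP[fp gp]; exists p => //; split; last first.
    by rewrite dotBl.
  apply/eqP; rewrite eq_le Xx//= (enorm_ge _ s0W).
  by move: fp; rewrite /f subr_ge0 -!enorm_sq enorm_distC.
exfalso; set m := - Num.min (f p) (g p).
have {}m0 : 0 < m by rewrite oppr_gt0.
have hm q : K q -> f q <= - m \/ g q <= - m.
  by move=> /hp; rewrite /m opprK ge_min => /orP.
(* Tilting [w] by [k] along [dir t] makes the functional increase strictly and
   costs the inactive constraint [g] only half of its margin [m]. *)
pose k := m / (2 * s); have k0 : 0 < k by rewrite divr_gt0 ?mulr_gt0.
have mk : m = 2 * s * k by rewrite /k mulrC divfK// gt_eqF// mulr_gt0.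
pose V := enorm w + k; have V0 : 0 < V by have := enorm_ge0 w; rewrite /V; lra.
have den : 0 < 2 * V * s + V * V + m + 1 by have := s0; nra.
pose e := m / (2 * V * s + V * V + m + 1).
have e0 : 0 < e by exact: divr_gt0.
have ee : e * (2 * V * s + V * V + m + 1) = m by rewrite /e divfK// gt_eqF.
have e1 : e < 1 by rewrite /e ltr_pdivrMr//; have := s0; nra.
have [eVs0 em0 eVV0] : [/\ 0 <= e * (V * s), 0 <= e * m & 0 <= e * (V * V)].
  by split; repeat (apply: mulr_ge0; try exact: ltW).
have eeV0 : 0 <= (1 - e) * (e * (V * V)) by apply: mulr_ge0 => //; rewrite subr_ge0 ltW.
have eVV : e * (V * V) <= m by lra.
have eVs : 2 * e * V * s + e * e * (V * V) <= m by lra.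
have wkV : enorm w + k <= V by [].
clearbody k e V m.
pose w' := w + k *: dir t.
have w'V : enorm w' <= V.
  by rewrite (le_trans (enormD _ _))// enormZ enorm_dir mulr1 ger0_norm// ltW.
have w'VV : dot w' w' <= V * V by rewrite -expr2 -(enorm_le _ (ltW V0)).
have Xe : X (x + e *: w').
  move=> q Kq; rewrite (enorm_le _ s0W).
  have wk : dot (x - q) w' <= g q + k * s.
    rewrite /w' dotDr dotZr dotBl /g lerD2l; apply: ler_wpM2l; first exact: ltW.
    by have := dot_dir_le (x - q) t; have := Xx q Kq; lra.
  have wV : dot (x - q) w' <= V * s.
    rewrite (le_trans (cauchy_schwarz _ _))// mulrC.
    by apply: ler_pM; rewrite ?enorm_ge0//; exact: Xx.
  have -> : dot (x + e *: w' - q) (x + e *: w' - q) =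
      dot (q - x) (q - x) + 2 * e * dot (x - q) w' + e * e * dot w' w'.
    by rewrite !dotE !mxE; ring.
  have := sq q Kq; case: (hm q Kq) => h.
    have h1 : e * dot (x - q) w' <= e * (V * s) by apply: ler_wpM2l => //; exact: ltW.
    have h2 : e * e * dot w' w' <= e * e * (V * V) by apply: ler_wpM2l => //; nra.
    by move: h; rewrite /f; lra.
  have h1 : e * dot (x - q) w' <= e * (- m + k * s) by apply: ler_wpM2l; [exact: ltW|lra].
  have h2 : e * dot w' w' <= m.
    by apply: le_trans eVV; apply: ler_wpM2l => //; exact: ltW.
  have h3 : e * (e * dot w' w') <= e * m by apply: ler_wpM2l => //; exact: ltW.
  have h4 : e * m = e * (2 * s * k) by rewrite mk.
  lra.
have := hx _ Xe; rewrite /w' !dot_lin dot_dir subrr cos0; nra.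
Qed.

Lemma contact_near x t c : X x ->
  (forall y, X y -> dot y (dir t) <= dot x (dir t)) -> 0 <= cos (c - t) ->
  exists2 r, c - pi / 2 <= r <= c + pi / 2 & K (x - s *: dir r).
Proof.
move=> Xx hx ct; have p0 := pi_gt0 R.
have [|p Kp [eps hp]] := @active_halfplane x t (dir c) Xx hx; first by rewrite dot_dir.
have [r rc e] := polar (x - p) (c - pi).
rewrite eps in e; exists r; last by rewrite -e subKr.
move: hp; rewrite e dotZl dot_dir pmulr_rge0// => /cos_ge0_range h.
have {h} : - (pi / 2) <= r - c <= pi / 2 by apply: h; lra.
lra.
Qed.

Lemma closed_contact x : closed [set r | K (x - s *: dir r)].
Proof.
have -> : [set r | K (x - s *: dir r)] = (fun r => x + (- s) *: dir r) @^-1` K.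
  by apply/seteqP; split=> r; rewrite /= scaleNr.
apply: preimage_closed; first by move=> r _; exact: dir_continuous.
exact: compact_plane_closed.
Qed.

(** The normal cone of the intersection of the disks at an extreme point is
    spanned by the radii ending there: a gap of more than a half-turn between
    consecutive radii would contradict optimality in the bisecting direction. *)
Lemma contact_bracket x t : X x ->
  (forall y, X y -> dot y (dir t) <= dot x (dir t)) ->
  exists t1 t2, [/\ t1 <= t <= t2, t2 <= t1 + pi,
    K (x - s *: dir t1) & K (x - s *: dir t2)].
Proof.
move=> Xx hx; have p0 := pi_gt0 R.
pose A (b c : R) := `[b, c] `&` [set r | K (x - s *: dir r)].
have cA b c : compact (A b c).
  by apply: compact_closedI; [exact: segment_compact|exact: closed_contact].
have idc : continuous (fun r : R => r) by move=> r; exact: cvg_id.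
have [t2 [t2t Kt2] min2] : exists2 t2, A t (t + pi) t2 & forall r, A t (t + pi) r -> t2 <= r.
  have [|r rt Kr] := @contact_near x t (t + pi / 2) Xx hx.
    by rewrite addrAC subrr add0r cos_pihalf.
  have A0 : A t (t + pi) !=set0 by exists r; split=> //=; rewrite in_itv/=; lra.
  have [t2 /set_mem At2 h] := compact_EVT_min A0 (cA _ _) (continuous_subspaceT idc).
  by exists t2 => // q Aq; apply: h; exact: mem_set.
have [t1 [t1t Kt1] max1] : exists2 t1, A (t - pi) t t1 & forall r, A (t - pi) t r -> r <= t1.
  have [|r rt Kr] := @contact_near x t (t - pi / 2) Xx hx.
    by rewrite addrAC subrr add0r cosN cos_pihalf.
  have A0 : A (t - pi) t !=set0 by exists r; split=> //=; rewrite in_itv/=; lra.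
  have [t1 /set_mem At1 h] := compact_EVT_max A0 (cA _ _) (continuous_subspaceT idc).
  by exists t1 => // q Aq; apply: h; exact: mem_set.
move: t1t t2t; rewrite /= !in_itv/= => t1t t2t.
have [le|gap] := leP t2 (t1 + pi); first by exists t1, t2; split => //; lra.
exfalso.
have [|r rt Kr] := @contact_near x t ((t1 + t2) / 2) Xx hx.
  apply: cos_ge0_pihalf; lra.
have [rt'|rt'] := leP r t.
  have := max1 r; suff h : A (t - pi) t r by move=> /(_ h); lra.
  by split=> //=; rewrite in_itv/=; lra.
have := min2 r; suff h : A t (t + pi) r by move=> /(_ h); lra.
by split=> //=; rewrite in_itv/=; lra.
Qed.

Lemma touching_bracket t : exists t1 t2, [/\ t1 <= t <= t2, t2 <= t1 + pi,
  touching t1 /\ touching t2, extreme_pt t1 = extreme_pt t & extreme_pt t2 = extreme_pt t].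
Proof.
have [Xx hx] := extreme_ptP t.
have [t1 [t2 [t12 le K1 K2]]] := contact_bracket Xx hx.
have e1 := touch_extreme Xx K1; have e2 := touch_extreme Xx K2.
by exists t1, t2; split; rewrite // /touching /foot ?e1 ?e2.
Qed.

End BallDual.

(** * Polygons inscribed in the inner parallel body *)

Section Polygons.
Context (R : realType).
Implicit Types (x y z p q u v : 'rV[R]_2) (s : seq 'rV[R]_2) (a b c t : R).

Fixpoint path_length x s : R :=
  if s is y :: s' then enorm (y - x) + path_length y s' else 0.

Lemma path_length_rcons x s y :
  path_length x (rcons s y) = path_length x s + enorm (y - last x s).
Proof. by elim: s x => [|z s IH] x /=; rewrite ?add0r ?addr0// IH addrA. Qed.

Lemma path_length_sum x s :
  path_length x s = \sum_(i < size s) enorm ((x :: s)`_i.+1 - (x :: s)`_i).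
Proof.
by elim: s x => [|y s IH] x; rewrite ?big_ord0//= big_ord_recl/= IH.
Qed.

Lemma polygon_length_path x s : s != [::] -> last x s = x ->
  path_length x s = polygon_length s.
Proof.
case: s => // y s _ e; rewrite [LHS]/= path_length_sum.
rewrite /polygon_length big_ord_recr/= modnn addrC; congr (_ + _).
  by rewrite -[in LHS]e (last_nth 0).
by apply: eq_bigr => i _; rewrite modn_small//= ltnS; exact: ltn_ord.
Qed.

Lemma perimeter_ge (E : set 'rV[R]_2) s r : convex_polygon s ->
  {in s, forall p, bdry E p} -> r <= polygon_length s -> (r%:E <= perimeter E)%E.
Proof.
move=> cs bs rs; apply: (@le_trans _ _ (polygon_length s)%:E); first by rewrite lee_fin.
by apply: ereal_sup_ubound; exists s.
Qed.

Lemma perimeter_ge0 (E : set 'rV[R]_2) : (0 <= perimeter E)%E.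
Proof.
apply: (@perimeter_ge _ [::]); first by move=> i j k _; rewrite ltn0.
- by move=> p; rewrite in_nil.
- by rewrite /polygon_length big_ord0.
Qed.

Lemma orient_rot p q r : orient p q r = orient q r p.
Proof. by rewrite /orient !mxE; ring. Qed.

Lemma orient_dir p q r a b : orient p q r * sin (b - a) =
  dot (q - p) (dir a) * dot (r - q) (dir b) - dot (q - p) (dir b) * dot (r - q) (dir a).
Proof. by rewrite /orient !dotE !mxE/= sinB; ring. Qed.

(** Whichever side of [q] the third edge turns to in the direction of [b], one
    of the two gaps shows a left turn. *)
Lemma orient_of_extremes p q r a b c :
  dot q (dir a) < dot p (dir a) -> dot r (dir a) < dot p (dir a) ->
  dot p (dir b) < dot q (dir b) -> dot r (dir b) < dot q (dir b) ->
  dot p (dir c) < dot r (dir c) -> dot q (dir c) < dot r (dir c) ->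
  0 < sin (b - a) -> 0 < sin (c - b) -> 0 < orient p q r.
Proof.
move=> qa ra pb rb pc qc sab sbc.
have [h|h] := leP (dot r (dir b)) (dot p (dir b)).
  rewrite -(pmulr_lgt0 _ sab) 2!orient_rot orient_dir !dotBl.
  have h1 : 0 < (dot p (dir a) - dot r (dir a)) * (dot q (dir b) - dot p (dir b)).
    by rewrite mulr_gt0 ?subr_gt0.
  have h2 : 0 <= (dot p (dir b) - dot r (dir b)) * (dot p (dir a) - dot q (dir a)).
    by rewrite mulr_ge0 ?subr_ge0// ltW.
  lra.
rewrite -(pmulr_lgt0 _ sbc) orient_rot orient_dir !dotBl.
have h1 : 0 < (dot q (dir b) - dot r (dir b)) * (dot r (dir c) - dot p (dir c)).
  by rewrite mulr_gt0 ?subr_gt0.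
have h2 : 0 < (dot r (dir c) - dot q (dir c)) * (dot r (dir b) - dot p (dir b)).
  by rewrite mulr_gt0 ?subr_gt0.
lra.
Qed.

End Polygons.

Section Inscribed.
Context (R : realType).
Implicit Types (a b c t v : R).
Variables (K : set 'rV[R]_2) (s : R).
Hypotheses (hK : width_one K) (s01 : 0 < s <= 1).
Hypothesis X0 : ball_dual K s !=set0.
Local Notation X := (ball_dual K s).
Local Notation e := (extreme_pt K s).

Lemma orient_extreme a b c : a < b < c -> c < a + pi *+ 2 ->
  e a != e b -> e b != e c -> e a != e c -> 0 < orient (e a) (e b) (e c).
Proof.
move=> abc c2 ab bc ac; have p0 := pi_gt0 R.
have lt t r : e t != e r -> dot (e t) (dir r) < dot (e r) (dir r).
  by move=> h; apply: extreme_pt_lt => //; exact: extreme_pt_in.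
have [ba ca cb] : [/\ e b != e a, e c != e a & e c != e b] by rewrite !(eq_sym (e c)) (eq_sym (e b)).
have sac : a + pi *+ 2 - c < pi -> 0 < sin (a - c).
  move=> h; rewrite -sinD2pi addrAC sin_gt0_pi//.
  by apply/andP; split; lra.
have [h1|h1] := ltP (b - a) pi; last first.
  rewrite orient_rot; apply: (@orient_of_extremes _ _ _ _ b c a); rewrite ?lt//.
    by rewrite sin_gt0_pi//; lra.
  by apply: sac; lra.
have [h2|h2] := ltP (c - b) pi; last first.
  rewrite 2!orient_rot; apply: (@orient_of_extremes _ _ _ _ c a b); rewrite ?lt//.
    by apply: sac; lra.
  by rewrite sin_gt0_pi//; lra.
apply: (@orient_of_extremes _ _ _ _ a b c); rewrite ?lt//.
  by rewrite sin_gt0_pi//; lra.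
by rewrite sin_gt0_pi//; lra.
Qed.

Lemma extreme_pt_bdry t : bdry X (e t).
Proof.
have [Xe he] := extreme_ptP hK s01 X0 t.
split; first exact: subset_closure.
move=> /interior_diskP[r r0 rX].
have /he : X (e t + r *: dir t).
  by apply: rX; rewrite /disk/= addrC addKr enormZ enorm_dir mulr1 ger0_norm// ltW.
by rewrite dotDl dotZl dot_dir subrr cos0; lra.
Qed.

(** Dropping the steps that do not move the extreme point makes the inscribed
    polygon strictly convex. Only a lower bound [v] of the length is recorded,
    so that chains can be extended by estimates of single steps. *)
Definition reach a b v := exists l : seq R,
  [/\ path <%R a l, path (fun t r => e t != e r) a l, last a l <= b,
      e (last a l) = e b & v <= path_length (e a) (map e l)].

Lemma reach_refl a : reach a a 0.
Proof. by exists [::]; split. Qed.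

Lemma reach_step a b c v w : reach a b v -> b < c -> w <= enorm (e c - e b) ->
  reach a c (v + w).
Proof.
move=> [l [p1 p2 lb eb vl]] bc wl.
have [ecb|necb] := eqVneq (e c) (e b).
  exists l; split=> //; rewrite ?ecb//; first by apply: le_trans lb _; exact: ltW.
  by move: wl; rewrite ecb subrr enorm0; lra.
exists (rcons l c); split; rewrite ?last_rcons//.
- by rewrite rcons_path p1 (le_lt_trans lb).
- by rewrite rcons_path p2 eb eq_sym.
- by rewrite map_rcons path_length_rcons last_map eb; lra.
Qed.

Lemma reach_weaken a b v w : reach a b v -> w <= v -> reach a b w.
Proof. by move=> [l [p1 p2 lb eb vl]] wv; exists l; split=> //; exact: le_trans vl. Qed.

(** Distinct consecutive extreme points are distinct altogether, because an
    extreme point shared by two directions is shared by all directions between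
    them on one side. *)
Lemma reach_perimeter a v : reach a (a + pi *+ 2) v -> (v%:E <= perimeter X)%E.
Proof.
move=> [l [p1 p2 lb el vl]].
have [l0|l0] := eqVneq l [::].
  by apply: le_trans (perimeter_ge0 _); rewrite lee_fin; move: vl; rewrite l0.
pose T i := (a :: l)`_i.
have incr i j : (i < j <= size l)%N -> T i < T j.
  move=> /andP[ij jl]; apply: (sorted_ltn_nth lt_trans) => //.
  by rewrite inE/= ltnS (leq_trans (ltnW ij)).
have last_le i : (i <= size l)%N -> T i <= a + pi *+ 2.
  move=> il; apply: le_trans lb; rewrite (last_nth 0).
  rewrite leq_eqVlt in il; case/orP: il => [/eqP ->//|il].
  by apply/ltW/incr; rewrite il leqnn.
have step i : (i < size l)%N -> e (T i) != e (T i.+1).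
  by move=> il; have /(pathP 0)/(_ i il) := p2.
have neq i j : (0 < i < j)%N -> (j <= size l)%N -> e (T i) != e (T j).
  case: i => // i; case: j => // j /= ij jl; apply/eqP => eij.
  have [le|gt] := leP (T j.+1) (T i.+1 + pi).
    have := step j jl; rewrite -eij; apply/negP; rewrite negbK; apply/eqP.
    apply: (@extreme_pt_const R K s hK s01 X0 (T i.+1) (T j.+1)) => //.
    have -> /= : T j <= T j.+1 by apply/ltW/incr; rewrite leqnn.
    rewrite andbT; rewrite ltnS leq_eqVlt in ij; case/orP: ij => [/eqP ->//|ij].
    by apply/ltW/incr; rewrite ij ltnW.
  have il : (i < size l)%N by apply: ltn_trans jl.
  have := step i il; apply/negP; rewrite negbK; apply/eqP.
  rewrite -(extreme_ptD2pi K s (T i)) eij.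
  have ai : a <= T i.
    have -> : a = T 0 by []; case: (i) il => [//|k] kl.
    by apply/ltW/incr; rewrite /= ltnW.
  apply: (@extreme_pt_const R K s hK s01 X0 (T j.+1) (T i.+1 + pi *+ 2)).
  - have := last_le j.+1 jl; have := incr i i.+1; rewrite leqnn il => /(_ isT).
    by move=> *; apply/andP; split; lra.
  - lra.
  - by rewrite extreme_ptD2pi eij.
have nthT i : (i < size l)%N -> (map e l)`_i = e (T i.+1).
  by move=> il; rewrite (nth_map 0).
apply: (@perimeter_ge _ _ (map e l)).
- move=> i j k /andP[ij jk]; rewrite size_map => kl.
  have jl := ltn_trans jk kl; have il := ltn_trans ij jl.
  rewrite !nthT//; apply: orient_extreme; rewrite ?neq ?ltnS//.
  + by rewrite !incr ?ltnS ?ij ?jk.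
  + apply: le_lt_trans (last_le _ kl) _; rewrite ltrD2r.
    by have -> : a = T 0 by []; apply: incr.
  + exact: ltn_trans jk.
- by move=> _ /mapP[t _ ->]; exact: extreme_pt_bdry.
- rewrite -(@polygon_length_path _ (e a))//; first by case: (l) l0.
  by rewrite last_map el extreme_ptD2pi.
Qed.

End Inscribed.

(** * Lower bound for the perimeter *)

Section ArcLength.
Context (R : realType).
Implicit Types (x y z p q w : 'rV[R]_2) (a b c t v : R).
Variables (K : set 'rV[R]_2) (s : R) (H : R -> R).
Hypotheses (hK : width_one K) (s01 : 0 < s <= 1).
Hypothesis X0 : ball_dual K s !=set0.
Hypothesis dH : forall t, deriv_at H t (supportfun K t).
Local Notation X := (ball_dual K s).
Local Notation e := (extreme_pt K s).
Local Notation y := (foot K s).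
Local Notation touching := (touching K s).

Let K0 : K !=set0. Proof. by case: hK. Qed.
Let cK : compact K. Proof. by case: hK. Qed.

Lemma diam_le1 p q : K p -> K q -> enorm (p - q) <= 1.
Proof. by case: hK => _ _ hd _ /hd; exact. Qed.

Lemma deriv_shift (F : R -> R) k t d : deriv_at F (t + k) d ->
  deriv_at (fun u => F (u + k)) t d.
Proof.
move=> dF; rewrite -[d]mulr1.
apply: (@is_derive1_comp R F (fun u => u + k) t d 1) => //.
by have := deriv_add (deriv_id t) (deriv_const k t); rewrite addr0.
Qed.

(** Opposite support values add up to the width. *)
Lemma support_period t : H (t + pi *+ 2) - H t = pi.
Proof.
have p0 := pi_gt0 R; case: hK => _ _ _ hw.
have dS u : deriv_at (fun r => H r + H (r + pi)) u 1.
  by rewrite -(hw u); apply: deriv_add; [exact: dH|exact: deriv_shift].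
have d1 u : deriv_at (fun r : R => r) u 1 by exact: deriv_id.
have tp : t <= t + pi by lra.
have h1 := @increment_le R _ _ (fun=> 1) (fun=> 1) t (t + pi) tp (fun u _ => dS u) (fun u _ => d1 u) (fun _ _ => lexx 1).
have h2 := @increment_le R _ _ (fun=> 1) (fun=> 1) t (t + pi) tp (fun u _ => d1 u) (fun u _ => dS u) (fun _ _ => lexx 1).
by rewrite (mulr2n pi) addrA; move: h1 h2 => /=; lra.
Qed.

(** At touching directions this measures the boundary of [K] swept by the foot:
    the integral of [1 - supportfun K t], the support value in the direction
    opposite to [t], plus the tangential coordinate of the foot. *)
Definition arclen t := t - H t - dot (y t) (nor t).

(** Barbier's theorem: the whole boundary has length [pi]. *)
Lemma arclenD2pi t : arclen (t + pi *+ 2) - arclen t = pi.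
Proof.
have := support_period t; rewrite /arclen footD2pi norD2pi (mulr2n pi); lra.
Qed.

Lemma arclen_point p a b : K p -> a <= b ->
  dot p (nor b) - dot p (nor a) <= (b - H b) - (a - H a).
Proof.
move=> Kp ab; case: hK => _ _ _ hw.
have := @increment_le R (fun t => dot p (nor t)) (fun t => t - H t)
  (fun t => - dot p (dir t)) (fun t => 1 - supportfun K t) a b ab; apply.
- move=> t _; have := deriv_opp (deriv_dot_nor p t).
  by rewrite (_ : (fun _ => _) = fun t => dot p (nor t))//; apply/funext => u; rewrite opprK.
- by move=> t _; apply: deriv_add; [exact: deriv_id|apply: deriv_opp; exact: dH].
- move=> t _; have := support_ge K0 cK (t + pi) Kp.
  by rewrite dirDpi dotNr; have := hw t; lra.
Qed.

Lemma arclen_corner w a b : a <= b ->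
  (forall p t, K p -> a <= t <= b -> dot (p - w) (dir t) <= 0) ->
  (b - a) + (dot w (nor b) - dot w (nor a)) <= (b - H b) - (a - H a).
Proof.
move=> ab hw.
suff h : H b - H a <= - dot w (nor b) - - dot w (nor a) by lra.
apply: (@increment_le R H (fun t => - dot w (nor t)) (supportfun K)
  (fun t => dot w (dir t)) a b ab).
- by move=> t _; exact: dH.
- by move=> t _; exact: deriv_dot_nor.
- move=> t tab; have [p Kp ->] := support_attained K0 cK t.
  by have := hw p t Kp tab; rewrite dotBl; lra.
Qed.

(** The disk of radius [1 - s] about an extreme point lies in [K], so the
    point of [K] opposite to a foot is one unit away from it. *)
Lemma foot_min t p : touching t -> K p -> dot (y t) (dir t) <= dot p (dir t).
Proof.
move=> Kt Kp; case: hK => _ _ hd _.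
have Kz : K (y t + dir t).
  apply/hd => q Kq; rewrite /foot.
  have -> : e t - s *: dir t + dir t - q = (e t - q) + (1 - s) *: dir t.
    by apply: row2P; rewrite !mxE; ring.
  have := extreme_pt_in hK s01 X0 t Kq; have := enormD (e t - q) ((1 - s) *: dir t).
  by rewrite enormZ enorm_dir mulr1 ger0_norm; have := s01; lra.
have := diam_le1 Kz Kp; have := dot_dir_le (y t + dir t - p) t.
by rewrite dotBl dotDl dot_dir subrr cos0; lra.
Qed.

Lemma arclen_chord a b c : touching a -> touching b -> a <= c <= b ->
  dot (y a - y b) (nor c) <= arclen b - arclen a.
Proof.
move=> ta tb /andP[ac cb].
have := arclen_point ta ac; have := arclen_point tb cb.
by rewrite /arclen (dotBl (y a) (y b)); lra.
Qed.

Lemma dir_chord c d : dir (c + d) - dir (c - d) = (2 * sin d) *: nor c :> 'rV[R]_2.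
Proof. by apply: row2P; rewrite !mxE/= !(cosD, sinD, cosN, sinN); ring. Qed.

Lemma dir_chord_mid a b :
  dir b - dir a = (2 * sin ((b - a) / 2)) *: nor ((a + b) / 2) :> 'rV[R]_2.
Proof. by rewrite -dir_chord; congr (dir _ - dir _); field. Qed.

Lemma arclen_ge0 a b : touching a -> touching b -> a <= b < a + pi *+ 2 ->
  0 <= arclen b - arclen a.
Proof.
move=> ta tb ab; have [<-|ne] := eqVneq a b; first by rewrite subrr.
have lt : a < b by rewrite lt_neqAle ne; lra.
apply: le_trans (arclen_chord ta tb (_ : a <= (a + b) / 2 <= b)); last lra.
have p0 := pi_gt0 R.
have sp : 0 < 2 * sin ((b - a) / 2).
  by rewrite mulr_gt0// sin_gt0_pi//; apply/andP; split; lra.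
rewrite -(pmulr_rge0 _ sp) -dotZr -dir_chord_mid dotBr !(dotBl (y a) (y b)).
by have := foot_min ta tb; have := foot_min tb ta; lra.
Qed.

(** The displacement of the extreme point is that of the normal vector scaled
    by [s], less that of the foot; the projection to the mean tangent suffices,
    because [arclen_chord] bounds exactly this projection of the latter. *)
Lemma step_length a b : touching a -> touching b -> a <= b ->
  2 * s * sin ((b - a) / 2) - (arclen b - arclen a) <= enorm (e b - e a).
Proof.
move=> ta tb ab.
have := @arclen_chord a b ((a + b) / 2) ta tb; rewrite (_ : _ <= _ <= _ = true); last by apply/andP; split; lra.
move=> /(_ isT); have := dot_nor_le (e b - e a) ((a + b) / 2).
have -> : dot (e b - e a) (nor ((a + b) / 2)) =
    s * (2 * sin ((b - a) / 2)) - dot (y a - y b) (nor ((a + b) / 2)).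
  have -> : e b - e a = s *: (dir b - dir a) - (y a - y b).
    by rewrite /foot; apply: row2P; rewrite !mxE; ring.
  by rewrite (dotBl (s *: _)) dir_chord_mid !dotZl dot_nor subrr cos0 mulr1.
lra.
Qed.

(** The unit circle through the two feet is centred at a corner [w] of the
    intersection of the unit disks about them, which contains [K]. Hence [w]
    bounds the support function of [K] from above over the directions of the
    unit arc on the chord of the feet. Over the rest of the range the feet, as
    points of [K], bound the opposite support values from below. *)
Lemma jump_arclen a b : touching a -> touching b -> a <= b <= a + pi -> e a = e b ->
  exists A, [/\ 0 <= A <= pi / 6, sin A = s * sin ((b - a) / 2) &
    2 * A <= arclen b - arclen a].
Proof.
move=> ta tb ab eab; have p0 := pi_gt0 R; have s0 : 0 < s by case/andP: s01.
set B := (b - a) / 2; set c := (a + b) / 2.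
have B0 : 0 <= B <= pi / 2 by rewrite /B; apply/andP; split; lra.
have sB : 0 <= sin B by rewrite sin_ge0_pi//; lra.
have yab : y a - y b = (2 * (s * sin B)) *: nor c.
  have -> : y a - y b = s *: (dir b - dir a).
    by rewrite /foot eab; apply: row2P; rewrite !mxE; ring.
  rewrite dir_chord_mid scalerA.
  by congr (_ *: _); rewrite /B; ring.
have sA : s * sin B <= 2^-1.
  have := diam_le1 ta tb; rewrite yab enormZ enorm_nor mulr1 ger0_norm; first lra.
  by rewrite !mulr_ge0// ltW.
have sA0 : 0 <= s * sin B by rewrite mulr_ge0// ltW.
have d1 : -1 <= s * sin B <= 1 by apply/andP; split; lra.
pose A := asin (s * sin B).
have eA : sin A = s * sin B by rewrite asinK ?in_itv.
have Api : - (pi / 2) <= A <= pi / 2 by rewrite asin_geNpi2 ?asin_lepi2.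
have A0 : 0 <= A.
  by rewrite leNgt -lt_sin ?sin0 ?eA -?leNgt//; lra.
have A6 : A <= pi / 6.
  by rewrite leNgt -lt_sin ?sin_pi6 ?eA -?leNgt ?div1r//; lra.
have AB : A <= B.
  rewrite leNgt -lt_sin ?eA -?leNgt//; last lra.
  by have := s01; nra.
exists A; split => //; first by rewrite A0.
pose w := y a + dir (c - A).
have wa : w = y a + 1 *: dir (c - A) by rewrite scale1r.
have wb : w = y b + 1 *: dir (c + A).
  have := dir_chord c A; rewrite eA -yab scale1r /w => /eqP.
  by rewrite subr_eq => /eqP ->; rewrite addrA [y b + _]addrC subrK.
have [hB hc] : B = (b - a) / 2 /\ c = (a + b) / 2 by [].
have ac : a <= c - A by lra.
have cb : c + A <= b by lra.
have h1 := arclen_point ta ac; have h3 := arclen_point tb cb.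
have h2 : 2 * A + (dot w (nor (c + A)) - dot w (nor (c - A))) <= (c + A - H (c + A)) - (c - A - H (c - A)).
  have -> : 2 * A = (c + A) - (c - A) by ring.
  apply: arclen_corner => [|p t Kp tc]; first lra.
  by apply: (corner_extreme ltr01 tc _ wa wb); [lra|exact: diam_le1|exact: diam_le1].
have e1 : dot w (nor (c - A)) = dot (y a) (nor (c - A)).
  by rewrite wa scale1r dotDl dot_dirnor subrr sin0 addr0.
have e2 : dot w (nor (c + A)) = dot (y b) (nor (c + A)).
  by rewrite wb scale1r dotDl dot_dirnor subrr sin0 addr0.
rewrite /arclen; lra.
Qed.

End ArcLength.

Section Chains.
Context (R : realType).
Implicit Types (a b c t v : R).
Variables (K : set 'rV[R]_2) (s : R) (H : R -> R).
Hypotheses (hK : width_one K) (s01 : 0 < s <= 1).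
Hypothesis X0 : ball_dual K s !=set0.
Hypothesis dH : forall t, deriv_at H t (supportfun K t).
Local Notation e := (extreme_pt K s).
Local Notation touching := (touching K s).
Local Notation arclen := (arclen K s H).
Local Notation reach := (reach K s).

Variables (A1 B1 : R).
Hypotheses (A1pi : 0 < A1 <= pi / 2) (B1pi : 0 < B1 <= pi / 2).
Hypothesis AB1 : sin A1 = s * sin B1.

(** Narrower jumps turn by at most [B1 / A1] per unit length of the boundary of
    [K]; those wider than the threshold are singled out. *)
Definition wide_jump a b := [/\ touching a, touching b, a < b <= a + pi,
  e a = e b & B1 < (b - a) / 2].

(** Up to an additive constant, the guaranteed length of a chain up to [t]: [s]
    times the turning, less what narrow jumps can have wasted of it on the
    boundary length covered so far. The arbitrarily small [k] pays for the
    difference between arcs and chords in the short steps. *)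
Definition gain k t := (s - k) * t - s * (B1 / A1) * arclen t.

Lemma arc_slope_ge1 : 1 <= s * (B1 / A1).
Proof.
have [A10 A1p] := andP A1pi; have p0 := pi_gt0 R; have s0 : 0 < s by case/andP: s01.
have [B10 B1p] := andP B1pi; have [_ s1] := andP s01.
have sB : 0 <= s * B1 <= B1.
  by rewrite mulr_ge0 ?ler_piMl// ltW.
rewrite mulrA ler_pdivlMr// mul1r leNgt -lt_sin; [|lra|lra].
by rewrite -leNgt AB1; apply: sin_le_scale; apply/andP; split; lra.
Qed.

Lemma gain_step k a b : 0 < k -> touching a -> touching b -> a <= b ->
  b - a <= 4 * k -> b - a <= 1 -> gain k b - gain k a <= enorm (e b - e a).
Proof.
move=> k0 ta tb ab h4 h1; have p2 := pi_ge2 R; have s0 : 0 < s by case/andP: s01.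
apply: le_trans _ (step_length hK dH ta tb ab).
have M0 : 0 <= arclen b - arclen a.
  by apply: (arclen_ge0 hK s01 X0 dH ta tb); rewrite (mulr2n pi); apply/andP; split; lra.
have x0 : 0 <= (b - a) / 2 by lra.
have q := sin_ge_quadratic x0.
have h := arc_slope_ge1; rewrite /gain.
set M := arclen b - arclen a in M0 *.
have hM : M <= s * (B1 / A1) * M by rewrite ler_peMl.
have hs : (s - k) * (b - a) <= 2 * s * sin ((b - a) / 2).
  have h2 : s * ((b - a) / 2 - (b - a) / 2 * ((b - a) / 2) / 2) <= s * sin ((b - a) / 2).
    by apply: ler_wpM2l => //; exact: ltW.
  have h3 : s * ((b - a) * (b - a)) <= 4 * k * (b - a).
    have sq : (b - a) * (b - a) <= 4 * k * (b - a) by apply: ler_wpM2r; lra.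
    have sq0 : 0 <= (b - a) * (b - a) by apply: mulr_ge0; lra.
    by apply: le_trans sq; rewrite ler_piMl//; case/andP: s01.
  lra.
move: hM; rewrite /M; lra.
Qed.

Lemma gain_jump k a b : 0 < k -> touching a -> touching b -> a <= b <= a + pi ->
  e a = e b -> (b - a) / 2 <= B1 -> gain k b - gain k a <= 0.
Proof.
move=> k0 ta tb ab eab hB; have p0 := pi_gt0 R; have s0 : 0 < s by case/andP: s01.
have [A [A06 eA hA]] := jump_arclen hK s01 dH ta tb ab eab.
have [A10 A1p] := andP A1pi; have [B10 B1p] := andP B1pi.
have := @arc_ratio_le R s A ((b - a) / 2) A1 B1 s01.
move=> /(_ _ B1p _ _ eA AB1) h.
have {}h : A1 * ((b - a) / 2) <= A * B1 by apply: h; lra.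
have h2 : (b - a) / 2 <= B1 / A1 * A by rewrite mulrAC ler_pdivlMr// mulrC [B1 * A]mulrC.
have c0 : 0 < B1 / A1 by rewrite divr_gt0.
have h3 : B1 / A1 * (2 * A) <= B1 / A1 * (arclen b - arclen a) by apply: ler_wpM2l => //; exact: ltW.
have h4 : s * (b - a) <= s * (B1 / A1 * (arclen b - arclen a)) by apply: ler_wpM2l; lra.
have h5 : 0 <= k * (b - a) by rewrite mulr_ge0; lra.
rewrite /gain; lra.
Qed.

(** Beyond the short range [d] the feet bracketing the direction [a + d] have one
    extreme point: the chain steps to the first of them, unless it lies behind
    [a], and jumps to the second. Each round advances by at least [d]. *)
Lemma chain_nat a0 k : 0 < k -> forall (n : nat) a b, touching a -> touching b -> a <= b ->
  b - a <= Num.min 1 (4 * k) *+ n -> forall v, reach a0 a v ->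
  (exists a' b', [/\ wide_jump a' b', a <= a' & b' <= b]) \/
  reach a0 b (v + (gain k b - gain k a)).
Proof.
move=> k0; set d := Num.min 1 (4 * k).
have d0 : 0 < d by rewrite /d lt_min ltr01 mulr_gt0.
have [d1 d4] : d <= 1 /\ d <= 4 * k by rewrite /d !ge_min !lexx orbT.
elim=> [|n IH] a b ta tb ab ban v ra.
  rewrite mulr0n in ban; have <- : a = b by lra.
  by right; rewrite subrr addr0.
have step x y w : touching x -> touching y -> x <= y -> y - x <= d ->
    reach a0 x w -> reach a0 y (w + (gain k y - gain k x)).
  move=> tx ty xy yx rx; have [<-|ne] := eqVneq x y; first by rewrite subrr addr0.
  apply: reach_step rx _ _; first by rewrite lt_neqAle ne.
  by apply: gain_step => //; lra.
have jump x y w : touching x -> touching y -> x <= y <= x + pi -> e x = e y ->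
    reach a0 x w -> wide_jump x y \/ reach a0 y (w + (gain k y - gain k x)).
  move=> tx ty xy exy rx; have [<-|ne] := eqVneq x y; first by right; rewrite subrr addr0.
  have lt : x < y by rewrite lt_neqAle ne; lra.
  have [hB|hB] := leP ((y - x) / 2) B1.
    right; apply: reach_step rx lt _; rewrite exy subrr enorm0.
    exact: gain_jump.
  by left; split => //; lra.
have [bd|bd] := leP (b - a) d; first by right; exact: step.
have [t1 [t2 [t12 t2pi [tt1 tt2] e1 e2]]] := touching_bracket hK s01 X0 (a + d).
pose c := Num.min t2 b.
have cb : c <= b by rewrite /c ge_min lexx orbT.
have ct2 : c <= t2 by rewrite /c ge_min lexx.
have adc : a + d <= c by rewrite /c le_min; apply/andP; split; lra.
have tc : touching c by rewrite /c; case: (leP t2 b).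
have ec : e c = e t1.
  apply: (extreme_pt_const hK s01 X0 (b := t2)) => //; last by rewrite e1 e2.
  by apply/andP; split; lra.
have rest w : reach a0 c w -> (exists a' b', [/\ wide_jump a' b', a <= a' & b' <= b]) \/
    reach a0 b (w + (gain k b - gain k c)).
  move=> rc; have [|[a' [b' [wj a'c b'b]]]|] := IH c b tc tb cb _ w rc; last by right.
    by move: ban; rewrite mulrS; lra.
  by left; exists a', b'; split => //; lra.
have [at1|t1a] := leP a t1.
  have t1d : t1 - a <= d by lra.
  have t1c : t1 <= c <= t1 + pi by apply/andP; split; lra.
  have [wj|rc] := jump t1 c _ tt1 tc t1c (esym ec) (step a t1 v ta tt1 at1 t1d ra).
    by left; exists t1, c.
  have [|h] := rest _ rc; first by left.
  by right; apply: reach_weaken h _; lra.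
have ea : e a = e c.
  rewrite ec; apply: (extreme_pt_const hK s01 X0 (b := t2)) => //; last by rewrite e1 e2.
  by apply/andP; split; lra.
have ac : a <= c <= a + pi by apply/andP; split; lra.
have [wj|rc] := jump a c _ ta tc ac ea ra.
  by left; exists a, c.
have [|h] := rest _ rc; first by left.
by right; apply: reach_weaken h _; lra.
Qed.

Lemma chain a0 k a b v : 0 < k -> touching a -> touching b -> a <= b -> reach a0 a v ->
  (exists a' b', [/\ wide_jump a' b', a <= a' & b' <= b]) \/
  reach a0 b (v + (gain k b - gain k a)).
Proof.
move=> k0 ta tb ab ra.
have d0 : 0 < Num.min 1 (4 * k) by rewrite lt_min ltr01 mulr_gt0.
have := chain_nat (a0 := a0) k0 (n := Num.bound ((b - a) / Num.min 1 (4 * k))) ta tb ab.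
move: (Num.min _ _) d0 => d d0; apply => //.
have q0 : 0 <= (b - a) / d by rewrite divr_ge0 ?subr_ge0// ltW.
by have := archi_boundP q0; rewrite ltr_pdivrMr// mulr_natl => /ltW.
Qed.

Lemma gainD2pi k a : gain k (a + pi *+ 2) - gain k a =
  2 * pi * (s - k) - s * (B1 / A1) * pi.
Proof.
have := arclenD2pi s hK dH a; rewrite /gain (mulr2n pi) => h.
have -> : arclen (a + (pi + pi)) = arclen a + pi by lra.
ring.
Qed.

End Chains.

Section LowerBound.
Context (R : realType).
Implicit Types (x y z p q : 'rV[R]_2) (a b c t v k : R) (K : set 'rV[R]_2).

Lemma lee_subr_eps (x C : R) (P : \bar R) : 0 < C ->
  (forall k, 0 < k -> ((x - C * k)%:E <= P)%E) -> (x%:E <= P)%E.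
Proof.
move=> C0 h; apply/lee_subgt0Pr => d d0.
by have := h (d / C); rewrite divr_gt0// mulrC divfK ?gt_eqF// EFinB; exact.
Qed.

Lemma foot_dist K s a b : extreme_pt K s a = extreme_pt K s b -> a <= b <= a + pi -> 0 <= s ->
  enorm (foot K s a - foot K s b) = 2 * (s * sin ((b - a) / 2)).
Proof.
move=> eab ab s0; have p0 := pi_gt0 R.
have -> : foot K s a - foot K s b = s *: (dir b - dir a).
  by rewrite /foot eab; apply: row2P; rewrite !mxE; ring.
rewrite dir_chord_mid !enormZ enorm_nor mulr1 !ger0_norm//; first ring.
by rewrite mulr_ge0// sin_ge0_pi//; lra.
Qed.

Section WidthOne.
Variables (K : set 'rV[R]_2) (s : R).
Hypotheses (hK : width_one K) (s01 : 0 < s <= 1).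
Hypothesis X0 : ball_dual K s !=set0.
Local Notation X := (ball_dual K s).
Local Notation y := (foot K s).
Local Notation touching := (touching K s).

Variable Bs : R.
Hypotheses (Bspi : 0 < Bs <= pi / 2) (hBs : sin (pi / 6) = s * sin Bs).

Let pi6 : 0 < (pi / 6 : R) <= pi / 2.
Proof. by have := pi_gt0 R; lra. Qed.

Lemma support_primitive : exists H, forall t, deriv_at H t (supportfun K t).
Proof.
by case: hK => K0 cK _ _; apply: primitive_exists; exact: support_continuous.
Qed.

Lemma touching_exists : exists a, touching a.
Proof.
by have [t1 [_ [_ _ [tt1 _] _ _]]] := touching_bracket hK s01 X0 0; exists t1.
Qed.

Lemma touchingD2pi a : touching a -> touching (a + pi *+ 2).
Proof. by rewrite /touching footD2pi. Qed.

Lemma no_wide_jump a b : ~ wide_jump K s Bs a b.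
Proof.
move=> [ta tb ab eab hB]; have p0 := pi_gt0 R; have s0 : 0 < s by case/andP: s01.
have := diam_le1 hK ta tb; rewrite (foot_dist eab); [|lra|exact: ltW].
have : s * sin Bs < s * sin ((b - a) / 2) by rewrite ltr_pM2l// lt_sin//; have := Bspi; lra.
by rewrite -hBs sin_pi6; lra.
Qed.

(** No jump exceeds [Bs], because the two feet would be more than [1] apart. *)
Theorem perimeter_lower_bound : ((2 * pi * s - 6 * s * Bs)%:E <= perimeter X)%E.
Proof.
have [H dH] := support_primitive; have [a ta] := touching_exists; have p0 := pi_gt0 R.
apply: (@lee_subr_eps _ (2 * pi)) => [|k k0]; first lra.
have a2 : a <= a + pi *+ 2 by rewrite (mulr2n pi); lra.
have [[a' [b' [wj _ _]]]|r] := chain hK s01 X0 dH pi6 Bspi hBs k0 ta (touchingD2pi ta) a2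
  (reach_refl K s a); first by case: (no_wide_jump wj).
apply: le_trans (reach_perimeter hK s01 X0 r); rewrite lee_fin add0r.
rewrite (gainD2pi s hK dH) le_eqVlt; apply/orP; left; apply/eqP.
by move: (@pi R) p0 => q q0; field; rewrite gt_eqF.
Qed.

(** * The case of equality *)

Section Wide.
Hypothesis s1 : s < 1.
Variables (A1 B1 : R).
Hypotheses (A1pi : 0 < A1 <= pi / 2) (B1pi : 0 < B1 <= pi / 2).
Hypotheses (AB1 : sin A1 = s * sin B1) (B1s : B1 < Bs).
Hypothesis small : (perimeter X <= (2 * pi * s - 6 * s * Bs)%:E)%E.
Variable H : R -> R.
Hypothesis dH : forall t, deriv_at H t (supportfun K t).
Local Notation arclen := (arclen K s H).
Local Notation wide := (wide_jump K s B1).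

Lemma wide_jumpP a b : wide a b -> exists A, [/\ A1 < A <= pi / 6,
  b - a <= 2 * (Bs / (pi / 6) * A), 2 * A <= arclen b - arclen a &
  2 * sin A1 < enorm (y a - y b)].
Proof.
move=> wj; have [ta tb /andP[ab abpi] eab hB] := wj; have p0 := pi_gt0 R.
have s0 : 0 < s by case/andP: s01.
have ab' : a <= b <= a + pi by rewrite ltW.
have [A [A06 eA hA]] := jump_arclen hK s01 dH ta tb ab' eab.
have hBs' : (b - a) / 2 <= Bs.
  by rewrite leNgt; apply/negP => gt; apply: (@no_wide_jump a b); split => //; rewrite ab.
have ss : s * sin B1 < s * sin ((b - a) / 2).
  by rewrite ltr_pM2l// lt_sin//; have := B1pi; lra.
exists A; split => //.
- by rewrite -lt_sin ?eA ?AB1 ?ss//=; have := A1pi; lra.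
- have h : pi / 6 * ((b - a) / 2) <= A * Bs.
    by apply: (@arc_ratio_le R s A ((b - a) / 2) (pi / 6) Bs) => //; have := Bspi; lra.
  move: (@pi R) p0 h => q q0 h.
  have -> : 2 * (Bs / (q / 6) * A) = (A * Bs) * (2 / (q / 6)) by ring.
  have -> : b - a = q / 6 * ((b - a) / 2) * (2 / (q / 6)) by field; rewrite gt_eqF.
  by apply: ler_wpM2r => //; rewrite divr_ge0//; lra.
- by rewrite (foot_dist eab)// ?AB1; [lra|exact: ltW].
Qed.

Let c := Bs / (pi / 6).
Let c1 := B1 / A1.

Lemma arc_slope_lt : c1 < c.
Proof.
have p0 := pi_gt0 R; have [A10 _] := andP A1pi.
have h : pi / 6 * B1 < A1 * Bs.
  by apply: (@arc_ratio_lt R s A1 B1 (pi / 6) Bs) => //; have := Bspi; have := B1pi; have := A1pi; have := s01; have := B1s; have := s1; lra.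
rewrite /c /c1 ltr_pdivrMr// mulrAC ltr_pdivlMr ?divr_gt0//; lra.
Qed.

(** Here [w] is the total width of at most two wide jumps and [m] the length of
    the boundary of [K] over them. If no other jump is wide, the ratio of turning
    to boundary length stays below [c] on the remaining length, and the
    perimeter exceeds the bound. *)
Lemma deficit a w m n : 0 <= w <= c * n -> n <= m -> n <= 2 * (pi / 3) ->
  (forall k, 0 < k -> reach K s a (a + pi *+ 2)
     (2 * pi * (s - k) - (s - k) * w - s * c1 * (pi - m))) -> False.
Proof.
move=> /andP[w0 wn] nm n3 hr; have p0 := pi_gt0 R; have s0 : 0 < s by case/andP: s01.
have : ((2 * pi * s - s * w - s * c1 * (pi - m))%:E <= perimeter X)%E.
  apply: (@lee_subr_eps _ (2 * pi)) => [|k k0]; first lra.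
  apply: le_trans (reach_perimeter hK s01 X0 (hr k k0)); rewrite lee_fin.
  have : 0 <= k * w by apply: mulr_ge0 => //; exact: ltW.
  lra.
move=> /le_trans/(_ small); rewrite lee_fin => h.
have c10 : 0 < c1 by rewrite divr_gt0//; [case/andP: B1pi|case/andP: A1pi].
have h1 : 6 * Bs <= w + c1 * (pi - m).
  by rewrite -(ler_pM2l s0); lra.
have cpi : c * pi = 6 * Bs by rewrite /c; move: (@pi R) p0 => q q0; field; rewrite gt_eqF.
have h2 : c1 * (pi - m) <= c1 * (pi - n) by apply: ler_wpM2l; [exact: ltW|lra].
have h3 : 0 < (c - c1) * (pi - n) by rewrite mulr_gt0 ?subr_gt0 ?arc_slope_lt//; lra.
lra.
Qed.

(** Two wide jumps account for at most two thirds of the boundary of [K]. The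
    search for further ones starts again at the beginning of the first, so that
    the jumps found are disjoint. *)
Lemma three_wide_jumps : exists a1 b1 a2 b2 a3 b3,
  [/\ wide a1 b1, wide a2 b2, wide a3 b3 &
      [/\ b1 <= a2, b2 <= a3 & b3 <= a1 + pi *+ 2]].
Proof.
have p0 := pi_gt0 R; have s0 : 0 < s by case/andP: s01.
have ch := chain hK s01 X0 dH A1pi B1pi AB1.
have per := gainD2pi s hK dH A1 B1.
have skip a0 a b v : wide a b -> reach K s a0 a v -> reach K s a0 b v.
  move=> [_ _ /andP[ab _] eab _] r; rewrite -[v]addr0; apply: reach_step r ab _.
  exact: enorm_ge0.
pose seen a b := exists a' b', [/\ wide a' b', a <= a' & b' <= b].
have [a ta] := touching_exists.
have a2 : a <= a + pi *+ 2 by rewrite (mulr2n pi); lra.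
have [[a1 [b1 [w1 _ _]]]|none] := pselect (seen a (a + pi *+ 2)); last first.
  exfalso; apply: (@deficit a 0 0 0); rewrite ?mulr0 ?lexx//; first lra.
  move=> k k0; have [//|] := ch a k _ _ _ k0 ta (touchingD2pi ta) a2 (reach_refl K s a).
  move=> r; apply: reach_weaken r _; rewrite per /c1; lra.
have [ta1 tb1 /andP[ab1 _] eab1 _] := w1.
have [A [A16 hw1 hm1 _]] := wide_jumpP w1.
have [[a2' [b2 [w2 b1a2 b2a1]]]|none] := pselect (seen b1 (a1 + pi *+ 2)); last first.
  exfalso; apply: (@deficit a1 (b1 - a1) (arclen b1 - arclen a1) (2 * A)).
  - by rewrite /c; apply/andP; split; lra.
  - lra.
  - lra.
  move=> k k0; have b1e : b1 <= a1 + pi *+ 2.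
    by have [_ _ /andP[_ ?] _ _] := w1; rewrite (mulr2n pi); lra.
  have [//|] := ch a1 k _ _ _ k0 tb1 (touchingD2pi ta1) b1e (skip _ _ _ _ w1 (reach_refl K s a1)).
  move=> r; apply: reach_weaken r _; have := per k a1; rewrite /gain /c1; lra.
have [ta2 tb2 /andP[ab2 _] eab2 _] := w2.
have [A' [A26 hw2 hm2 _]] := wide_jumpP w2.
have [[a3 [b3 [w3 b1a3 b3a2]]]|none1] := pselect (seen b1 a2').
  by exists a1, b1, a3, b3, a2', b2.
have [[a3 [b3 [w3 b2a3 b3a1]]]|none2] := pselect (seen b2 (a1 + pi *+ 2)).
  by exists a1, b1, a2', b2, a3, b3.
exfalso; apply: (@deficit a1 ((b1 - a1) + (b2 - a2'))
   ((arclen b1 - arclen a1) + (arclen b2 - arclen a2')) (2 * A + 2 * A')).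
- by rewrite /c; apply/andP; split; lra.
- lra.
- lra.
move=> k k0.
have [//|r1] := ch a1 k _ _ _ k0 tb1 ta2 b1a2 (skip _ _ _ _ w1 (reach_refl K s a1)).
have [//|r2] := ch a1 k _ _ _ k0 tb2 (touchingD2pi ta1) b2a1 (skip _ _ _ _ w2 r1).
by apply: reach_weaken r2 _; have := per k a1; rewrite /gain /c1; lra.
Qed.

(** As each foot is extreme in its own direction, their difference is tangential
    in some intermediate direction, where [arclen_chord] applies to it. *)
Lemma foot_dist_arclen a b : touching a -> touching b -> a <= b < a + pi ->
  enorm (y a - y b) <= arclen b - arclen a.
Proof.
move=> ta tb ab; have p0 := pi_gt0 R.
have [eab|nab] := eqVneq a b; first by rewrite eab !subrr enorm0.
have {nab} lt : a < b by rewrite lt_neqAle nab; lra.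
have [d0|d0] := eqVneq (enorm (y a - y b)) 0.
  rewrite d0; apply: (arclen_ge0 hK s01 X0 dH ta tb).
  by rewrite (mulr2n pi); apply/andP; split; lra.
have {d0} d1 : 0 < enorm (y a - y b) by rewrite lt_def d0 enorm_ge0.
have [t ta2 e] := polar_nor (y a - y b) a.
rewrite (mulr2n pi) in ta2.
have h1 : 0 <= dot (y a - y b) (dir b).
  by rewrite (dotBl (y a)) subr_ge0; exact: (foot_min hK s01 X0).
have h2 : dot (y a - y b) (dir a) <= 0.
  by rewrite (dotBl (y a)) subr_le0; exact: (foot_min hK s01 X0).
rewrite e dotZl pmulr_rge0// dot_nordir -sinN opprB in h1.
rewrite e dotZl pmulr_rle0// dot_nordir oppr_le0 in h2.
have t1 : t - a <= pi.
  rewrite leNgt; apply/negP => gt.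
  have : 0 < sin (t - a - pi) by rewrite sin_gt0_pi//; lra.
  by have := sinDpi (t - a - pi); rewrite subrK; lra.
have tb1 : t <= b.
  rewrite leNgt; apply/negP => gt.
  have : 0 < sin (t - b) by rewrite sin_gt0_pi//; lra.
  by rewrite -opprB sinN; lra.
have := arclen_chord hK dH ta tb (_ : a <= t <= b).
rewrite {1}e dotZl dot_nor subrr cos0 mulr1; apply; lra.
Qed.

End Wide.
End WidthOne.
End LowerBound.

Section Triangle.
Context (R : realType).
Implicit Types (x y z p q r : 'rV[R]_2) (K : set 'rV[R]_2).

(** The chords of the three wide jumps have nearly unit length, and the feet
    between consecutive jumps are close together, because the jumps exhaust
    nearly all of the boundary. *)
Lemma near_triangle K (s Bs e : R) : width_one K -> 0 < s < 1 -> ball_dual K s !=set0 ->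
  0 < Bs <= pi / 2 -> sin (pi / 6) = s * sin Bs ->
  (perimeter (ball_dual K s) <= (2 * pi * s - 6 * s * Bs)%:E)%E -> 0 < e ->
  exists p q r, [/\ K p, K q, K r &
    [/\ 1 - e <= enorm (p - q), 1 - e <= enorm (q - r) & 1 - e <= enorm (r - p)]].
Proof.
move=> hK s01 X0 Bspi hBs small e0; have p0 := pi_gt0 R; have p2 := pi_ge2 R.
have [s0 s1] := andP s01; have sl : 0 < s <= 1 by rewrite s0 ltW.
(* With [A1 = pi / 6 - d] each chord falls short of 1 by at most 2d and the
   gaps between jumps are at most 6d long; the second bound on d makes B1
   exceed pi / 6, so that each gap is less than a half-turn. *)
pose d := Num.min (e / 8) (Num.min ((1 - s) / 4) (pi / 12)).
have d0 : 0 < d by rewrite !lt_min !divr_gt0// subr_gt0.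
have [d1 d2 d3] : [/\ d <= e / 8, d <= (1 - s) / 4 & d <= pi / 12].
  by rewrite /d !ge_min !lexx ?orbT.
clearbody d.
have a16 : pi / 6 - d <= pi / 6 by lra.
have s6 := sin_pi6 R.
have sA1 : 1 / 2 - d <= sin (pi / 6 - d) by have := sin_sub_le a16; rewrite s6; lra.
have sA1' : sin (pi / 6 - d) < 1 / 2 by rewrite -s6 lt_sin; lra.
set A1 := pi / 6 - d in a16 sA1 sA1' *.
have sB1 : sin A1 / s < sin Bs by rewrite ltr_pdivrMr// mulrC -hBs s6.
have sB2 : 1 / 2 < sin A1 / s by rewrite ltr_pdivlMr//; lra.
have sBs1 := sin_le1 Bs.
have dom : -1 <= sin A1 / s <= 1 by apply/andP; split; lra.
pose B1 := asin (sin A1 / s).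
have eB1 : sin B1 = sin A1 / s by rewrite asinK ?in_itv.
have B1r : - (pi / 2) <= B1 <= pi / 2 by rewrite asin_geNpi2 ?asin_lepi2.
have AB1 : sin A1 = s * sin B1 by rewrite eB1 mulrC divfK// gt_eqF.
have B16 : pi / 6 < B1 by rewrite -lt_sin ?s6 ?eB1//; lra.
have B1s : B1 < Bs by rewrite -lt_sin ?eB1//; lra.
have A1pi : 0 < A1 <= pi / 2 by rewrite /A1; apply/andP; split; lra.
have B1pi : 0 < B1 <= pi / 2 by apply/andP; split; lra.
have [H dH] := support_primitive hK.
have [a1 [b1 [a2 [b2 [a3 [b3 [w1 w2 w3 [g1 g2 g3]]]]]]]] :=
  three_wide_jumps hK sl X0 Bspi hBs s1 A1pi B1pi AB1 B1s small dH.
have wP := wide_jumpP hK sl Bspi hBs A1pi B1pi AB1 dH.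
have [? [/andP[l1 _] _ m1 n1]] := wP _ _ w1.
have [? [/andP[l2 _] _ m2 n2]] := wP _ _ w2.
have [? [/andP[l3 _] _ m3 n3]] := wP _ _ w3.
have [ta1 tb1 /andP[ab1 _] _ h1] := w1.
have [ta2 tb2 /andP[ab2 _] _ h2] := w2.
have [ta3 tb3 /andP[ab3 _] _ h3] := w3.
have ta1' : touching K s (a1 + pi *+ 2) by exact: touchingD2pi.
have per := arclenD2pi s hK dH a1.
have gap a b : touching K s a -> touching K s b -> a <= b -> b < a + pi ->
    enorm (foot K s a - foot K s b) <= arclen K s H b - arclen K s H a.
  by move=> ta tb ab ba; apply: (foot_dist_arclen hK sl X0 dH ta tb); rewrite ab.
rewrite (mulr2n pi) in g3 ta1' per.
have A1d : A1 = pi / 6 - d by [].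
have [r1 r2 r3] : [/\ a2 < b1 + pi, a3 < b2 + pi & a1 + (pi + pi) < b3 + pi].
  by clear -g1 g2 g3 h1 h2 h3 B16; split; lra.
have k1 := gap _ _ tb1 ta2 g1 r1; have k2 := gap _ _ tb2 ta3 g2 r2.
have k3 := gap _ _ tb3 ta1' g3 r3.
have sum : (arclen K s H a2 - arclen K s H b1) + (arclen K s H a3 - arclen K s H b2) +
    (arclen K s H (a1 + (pi + pi)) - arclen K s H b3) <= 6 * d.
  by clear -per m1 m2 m3 l1 l2 l3 A1d; lra.
have ya1 : foot K s (a1 + (pi + pi)) = foot K s a1 by rewrite -(mulr2n pi) footD2pi.
rewrite ya1 in k3.
have [q1 q2 q3] := And3 (enorm_ge0 (foot K s b1 - foot K s a2))
  (enorm_ge0 (foot K s b2 - foot K s a3)) (enorm_ge0 (foot K s b3 - foot K s a1)).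
have close x y z : 2 * sin A1 < enorm (x - y) -> enorm (y - z) <= 6 * d ->
    1 - e <= enorm (x - z).
  have := enorm_triangle x z y; rewrite (enorm_distC z y).
  by clear -sA1 d1; lra.
have three (u1 u2 u3 v1 v2 v3 g : R) : 0 <= u1 -> 0 <= u2 -> 0 <= u3 ->
    u1 <= v1 -> u2 <= v2 -> u3 <= v3 -> v1 + v2 + v3 <= g ->
    [/\ u1 <= g, u2 <= g & u3 <= g].
  by clear; move=> *; split; lra.
have [c1 c2 c3] := three _ _ _ _ _ _ _ q1 q2 q3 k1 k2 k3 sum.
exists (foot K s a1), (foot K s a2), (foot K s a3).
split; [exact: ta1|exact: ta2|exact: ta3|split].
- exact: close n1 c1.
- exact: close n2 c2.
- exact: close n3 c3.
Qed.

Lemma dist2_continuous2 (T : topologicalType) (f g : T -> 'rV[R]_2) :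
  continuous f -> continuous g -> continuous (fun u => dot (f u - g u) (f u - g u)).
Proof.
move=> cf cg.
have c i (h : T -> 'rV[R]_2) : continuous h -> continuous (fun u => h u 0 i).
  by move=> ch u; apply: (@continuous_comp _ _ _ h (fun x => x 0 i) u); [exact: ch|exact: coord_continuous].
pose k i u := f u 0 i + (- 1) * g u 0 i.
have ck i : continuous (k i).
  by apply: continuous_addf; [exact: c|apply: continuous_mulf; [exact: cst_continuous|exact: c]].
rewrite (_ : (fun _ => _) = (fun u => k 0 u * k 0 u + k 1 u * k 1 u)).
  by apply: continuous_addf; apply: continuous_mulf; exact: ck.
by apply/funext => u; rewrite dotE !mxE /k !mulN1r.
Qed.

(** The shortest side of a triangle attains its maximum over the triples of
    points of a compact set. *)
Lemma unit_triangle_of_near K : width_one K ->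
  (forall e, 0 < e -> exists p q r, [/\ K p, K q, K r &
    [/\ 1 - e <= enorm (p - q), 1 - e <= enorm (q - r) & 1 - e <= enorm (r - p)]]) ->
  exists p q r, [/\ K p, K q, K r &
    [/\ enorm (p - q) = 1, enorm (q - r) = 1 & enorm (r - p) = 1]].
Proof.
move=> hK near; have [K0 cK _ _] := hK.
pose V := ('rV[R]_2 * ('rV[R]_2 * 'rV[R]_2))%type.
pose f (u : V) := Num.min (dot (u.1 - u.2.1) (u.1 - u.2.1))
  (Num.min (dot (u.2.1 - u.2.2) (u.2.1 - u.2.2)) (dot (u.2.2 - u.1) (u.2.2 - u.1))).
have c1 : continuous (fun u : V => u.1) by move=> u; exact: cvg_fst.
have c2 : continuous (fun u : V => u.2) by move=> u; exact: cvg_snd.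
have c21 : continuous (fun u : V => u.2.1).
  by move=> u; apply: (@continuous_comp _ _ _ (fun u : V => u.2) fst u); [exact: c2|exact: cvg_fst].
have c22 : continuous (fun u : V => u.2.2).
  by move=> u; apply: (@continuous_comp _ _ _ (fun u : V => u.2) snd u); [exact: c2|exact: cvg_snd].
have cf : continuous f.
  have h1 := dist2_continuous2 c1 c21; have h2 := dist2_continuous2 c21 c22.
  have h3 := dist2_continuous2 c22 c1.
  have h23 : continuous (fun u : V => Num.min (dot (u.2.1 - u.2.2) (u.2.1 - u.2.2))
      (dot (u.2.2 - u.1) (u.2.2 - u.1))).
    by move=> u; exact: (@continuous_min _ _ _ _ u (h2 u) (h3 u)).
  by move=> u; exact: (@continuous_min _ _ _ _ u (h1 u) (h23 u)).
pose K3 := K `*` (K `*` K).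
have cK3 : compact K3 by do 2 (apply: compact_setX => //).
have [p0 Kp0] := K0.
have K30 : K3 !=set0 by exists (p0, (p0, p0)).
have [[p [q r]] /set_mem[/= Kp [/= Kq Kr]] hm] :=
  compact_EVT_max K30 cK3 (continuous_subspaceT cf).
have f1 : 1 <= f (p, (q, r)).
  rewrite leNgt; apply/negP => lt1.
  pose e := (1 - f (p, (q, r))) / 2.
  have e0 : 0 < e by rewrite divr_gt0// subr_gt0.
  have fe : f (p, (q, r)) = 1 - 2 * e by rewrite /e; field.
  have fpos : 0 <= f (p, (q, r)) by rewrite /f !le_min !dot_ge0.
  have [p' [q' [r' [Kp' Kq' Kr' [h1 h2 h3]]]]] := near (e / 2) ltac:(lra).
  have := hm (p', (q', r')); rewrite inE => /(_ (conj Kp' (conj Kq' Kr'))).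
  rewrite fe leNgt; apply/negP; rewrite negbK.
  have sq x : 1 - e / 2 <= enorm x -> 1 - 2 * e < dot x x.
    by move=> h; rewrite -enorm_sq; nra.
  by rewrite /f !lt_min !sq.
move: f1; rewrite /f/= !le_min => /and3P[f1 f2 f3].
have eq1 x y : K x -> K y -> 1 <= dot (x - y) (x - y) -> enorm (x - y) = 1.
  move=> Kx Ky h; apply/eqP; rewrite eq_le (diam_le1 hK)//=.
  by rewrite enorm_ge// expr1n.
by exists p, q, r; split => //; split; exact: eq1.
Qed.

Lemma sin_pi3_sq : sin (pi / 3) ^+ 2 = 3 / 4 :> R.
Proof.
have -> : pi / 3 = - (pi / 6) + pi / 2 :> R by field.
by rewrite sinDpihalf cosN cos2sin2 sin_pi6; field.
Qed.

Lemma perimeter_le0 (E : set 'rV[R]_2) x : (forall y, bdry E y -> y = x) ->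
  (perimeter E <= 0)%E.
Proof.
move=> hE; apply: ge_ereal_sup => _ [l [_ bl] <-]; rewrite lee_fin /polygon_length.
rewrite big1// => i _; have lE j : (j < size l)%N -> l`_j = x.
  by move=> jl; apply/hE/bl; exact: mem_nth.
rewrite !lE ?subrr ?enorm0//; apply: ltn_pmod; exact: leq_ltn_trans (ltn_ord i).
Qed.

Lemma corner_angle (s : R) : 0 < s -> 1 <= 3 * s ^+ 2 -> exists B,
  [/\ 0 < B <= pi / 3, sin (pi / 6) = s * sin B & (1 < 3 * s ^+ 2 -> B < pi / 3)].
Proof.
move=> s0 s3; have p0 := pi_gt0 R.
have k0 : 0 < 1 / (2 * s) by rewrite divr_gt0// mulr_gt0.
have ks : 1 / (2 * s) * (2 * s) = 1 by rewrite divfK// gt_eqF// mulr_gt0.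
move: (1 / _) k0 ks => k k0 ks.
have k1 : -1 <= k <= 1 by apply/andP; split; nra.
have eB : sin (asin k) = k by rewrite asinK ?in_itv.
have Br : - (pi / 2) <= asin k <= pi / 2 by rewrite asin_geNpi2 ?asin_lepi2.
have s30 : 0 <= sin (pi / 3) :> R by rewrite sin_ge0_pi//; lra.
have s3q := sin_pi3_sq.
exists (asin k); split.
- apply/andP; split; first by rewrite -lt_sin ?sin0 ?eB//; lra.
  rewrite leNgt -lt_sin ?eB//; last lra.
  by rewrite -leNgt -(@ler_pXn2r _ 2) ?nnegrE ?(ltW k0)// s3q; nra.
- by rewrite sin_pi6 eB; lra.
- move=> s3'; rewrite -lt_sin ?eB//; last lra.
  by rewrite -(@ltr_pXn2r _ 2) ?nnegrE ?(ltW k0)// s3q; nra.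
Qed.

(** The perimeter bound at the circumradius of [K], where the intersection of
    the disks is a single point, is Jung's inequality. *)
Lemma jung K (s : R) : width_one K -> 0 < s <= 1 -> 1 <= 3 * s ^+ 2 -> ball_dual K s !=set0.
Proof.
move=> hK s01 s3; have [K0 cK hd _] := hK; have p0 := pi_gt0 R.
have [s0 s1] := andP s01.
pose G x := sup [set enorm (x - p) | p in K].
have GP x : exists2 p, K p & G x = enorm (x - p) /\ forall q, K q -> enorm (x - q) <= G x.
  have [p Kp hp] := compact_argmax K0 cK (@dist2_continuous _ x).
  have hp' q : K q -> enorm (x - q) <= enorm (x - p).
    move=> Kq; rewrite (enorm_distC x q) (enorm_distC x p) enorm_le ?enorm_ge0//.
    by rewrite enorm_sq; exact: hp.
  exists p => //; have -> : G x = enorm (x - p); last by split.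
  apply/eqP; rewrite eq_le; apply/andP; split.
    by apply: ge_sup; [exists (enorm (x - p)), p|move=> _ [q Kq <-]; exact: hp'].
  by apply: ub_le_sup; [exists (enorm (x - p)) => _ [q Kq <-]; exact: hp'|exists p].
have cG : continuous G.
  have lip u v : G u - G v <= enorm (u - v).
    have [p Kp [-> _]] := GP u; have [_ _ [_ /(_ p Kp)]] := GP v.
    by have := enorm_triangle u v p; lra.
  move=> x U /nbhs_ballP[e /= e0 eU]; apply/(interior_diskP (G @^-1` U)).
  exists (e / 2) => [|z]; first by rewrite divr_gt0.
  rewrite /disk/= => zx; apply: eU; rewrite /ball/= ltr_norml.
  by have := lip x z; have := lip z x; rewrite (enorm_distC x z); lra.
have [x0 Kx0 hx0] := compact_argmin K0 cK cG.
set rho := G x0 in hx0.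
have rho1 : rho <= 1.
  have [p Kp [e _]] := GP x0; rewrite /rho e; exact: (diam_le1 hK Kx0 Kp).
have dualG x : ball_dual K (G x) x by move=> p Kp; have [_ _ [_]] := GP x; exact.
have [le|gt] := leP rho s.
  by exists x0 => p Kp; apply: le_trans le; exact: dualG.
exfalso.
have rho0 : 0 < rho by lra.
have rho01 : 0 < rho <= 1 by rewrite rho0.
have Xr0 : ball_dual K rho !=set0 by exists x0; exact: dualG.
have single x : ball_dual K rho x -> x = x0.
  move=> Xx; apply/eqP/negPn/negP => ne.
  have [e e0 he] := ball_dual_strict hK rho01 Xx (dualG x0) ne.
  set m := 2^-1 *: (x + x0) in he.
  have Km : K m.
    apply/hd => p Kp; apply: le_trans rho1; apply: he => //.
    by rewrite subrr enorm0 ltW.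
  have [p Kp [Gm _]] := GP m.
  have [t _ ht] := polar (m - p) 0.
  have := he (m + e *: dir t); rewrite addrAC subrr add0r enormZ enorm_dir mulr1 (ger0_norm (ltW e0)).
  move=> /(_ (lexx e) p Kp).
  have -> : m + e *: dir t - p = (enorm (m - p) + e) *: dir t by rewrite scalerDl -ht addrAC.
  rewrite enormZ enorm_dir mulr1 (ger0_norm (addr_ge0 (enorm_ge0 _) (ltW e0))).
  by have := hx0 m Km; rewrite Gm; lra.
have rho3 : 1 < 3 * rho ^+ 2 by nra.
have [B [B0 hB B3]] := corner_angle rho0 (ltW rho3).
have {}B3 := B3 rho3.
have Bpi : 0 < B <= pi / 2 by apply/andP; split; lra.
have := perimeter_lower_bound hK rho01 Xr0 Bpi hB.
rewrite leNgt; apply/negP; rewrite negbK.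
apply: le_lt_trans (@perimeter_le0 _ x0 _) _.
  by move=> y /(bdry_compact_sub (ball_dual_compact hK rho01)); exact: single.
by rewrite lte_fin; nra.
Qed.

End Triangle.

(** * Upper bound for the perimeter *)

Section ConvexPolygons.
Context (R : realType).
Implicit Types (x y z p q : 'rV[R]_2) (l : seq 'rV[R]_2) (a b c t : R).

Lemma sin_gt0_lt_pi t : 0 < sin t -> 0 <= t < pi *+ 2 -> 0 < t < pi.
Proof.
move=> st; rewrite (mulr2n pi) => tpi; have p0 := pi_gt0 R; apply/andP; split.
  by rewrite lt_def; case: eqVneq st => [->|_ _]; [rewrite sin0 ltxx|case/andP: tpi].
rewrite ltNge; apply/negP => gt; have : 0 <= sin (t - pi) by rewrite sin_ge0_pi//; lra.
by have := sinDpi (t - pi); rewrite subrK; lra.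
Qed.

Lemma sin_gt0_gt0 t : 0 < sin t -> - pi < t < pi -> 0 < t.
Proof.
move=> st tpi; rewrite ltNge; apply/negP => le.
have : 0 <= sin (- t) by rewrite sin_ge0_pi//; lra.
by rewrite sinN; lra.
Qed.

Lemma orient_nor p q x y (r k a b : R) : q - p = r *: nor a -> y - x = k *: nor b ->
  (q - p) 0 0 * (y - x) 0 1 - (q - p) 0 1 * (y - x) 0 0 = r * k * sin (b - a).
Proof. by move=> -> ->; rewrite !mxE/= sinB; ring. Qed.

Section Turning.
Variables (l : seq 'rV[R]_2) (H h : R -> R).
Hypothesis dH : forall t, deriv_at H t (h t).
Hypothesis lh : {in l, forall p t, dot p (dir t) <= h t}.
Hypothesis cl : convex_polygon l.

Lemma increment_point p a b : p \in l -> a <= b ->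
  dot p (nor a) - dot p (nor b) <= H b - H a.
Proof.
move=> pl ab; rewrite -(opprK (dot p (nor a))) addrC.
apply: (@increment_le R (fun t => - dot p (nor t)) H (fun t => dot p (dir t)) h a b ab).
- by move=> t _; exact: deriv_dot_nor.
- by move=> t _; exact: dH.
- by move=> t _; exact: lh.
Qed.

Let P i := l`_i.
Let m := size l.

(** Summation by parts: each vertex bounds [h] from below between the outer
    normal angles of its two edges. Here [w] is the normal angle of the last
    edge and [c] that of the diagonal from the initial vertex; following both
    keeps the angles increasing and the total turn within [pi *+ 2]. *)
Lemma polygon_tail w0 r1 : 0 < r1 -> P 1 - P 0 = r1 *: nor w0 ->
  forall n i, (0 < i)%N -> (i + n.+1 = m)%N -> forall c w r k, 0 < r -> 0 < k ->
  P i - P 0 = r *: nor c -> P i - P i.-1 = k *: nor w ->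
  w0 <= c <= w -> w <= c + pi -> c < w0 + pi ->
  \sum_(i <= j < m) enorm (P (j.+1 %% m) - P j) <=
  H (w0 + pi *+ 2) - H w - dot (P i) (nor w) + dot (P 0) (nor w0).
Proof.
move=> r10 e1; have p0 := pi_gt0 R.
elim=> [|n IH] i i0 im c w r k r0 k0 ec ew cw wc cw0.
  have mi : m = i.+1 by rewrite -im addn1.
  have il : (i < m)%N by rewrite mi.
  rewrite mi big_nat1 modnn.
  have eE : P 0 - P i = r *: nor (c + pi) by rewrite norDpi scalerN -ec opprB.
  have -> : enorm (P 0 - P i) = dot (P 0 - P i) (nor (c + pi)).
    by rewrite eE enormZ enorm_nor mulr1 dotZl dot_nor subrr cos0 mulr1 gtr0_norm.
  have m0 : (0 < m)%N by rewrite mi.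
  have c2 : c + pi <= w0 + pi *+ 2 by rewrite (mulr2n pi); lra.
  have := increment_point (mem_nth 0 il) wc.
  have := increment_point (mem_nth 0 m0) c2.
  by rewrite norD2pi dotBl /P; lra.
have il : (i < m)%N by rewrite -im addnS ltnS leq_addr.
have i1l : (i.+1 < m)%N by rewrite -im !addnS !ltnS leq_addr.
have [w' ww' ew'] := polar_nor (P i.+1 - P i) c.
have [c' cc' ec'] := polar_nor (P i.+1 - P 0) c.
set k' := enorm (P i.+1 - P i) in ew'; set r' := enorm (P i.+1 - P 0) in ec'.
have k'0 : 0 <= k' by exact: enorm_ge0.
have r'0 : 0 <= r' by exact: enorm_ge0.
have pos (u v d : R) : 0 <= u -> 0 <= v -> 0 < u * v * d -> [/\ 0 < u, 0 < v & 0 < d].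
  move=> u0 v0 uvd; have [u1|u1] := eqVneq u 0; first by move: uvd; rewrite u1 !mul0r ltxx.
  have [v1|v1] := eqVneq v 0; first by move: uvd; rewrite v1 mulr0 mul0r ltxx.
  have [u2 v2] : 0 < u /\ 0 < v by rewrite !lt_def u1 v1.
  by split=> //; rewrite -(pmulr_rgt0 _ (mulr_gt0 u2 v2)).
have cross_edge p q x : orient p q x = (q - p) 0 0 * (x - q) 0 1 - (q - p) 0 1 * (x - q) 0 0.
  by rewrite /orient !mxE; ring.
have o1 : 0 < orient (P 0) (P i) (P i.+1) by apply: cl; rewrite ?i0 ?leqnn.
have [_ k'1 s1] : [/\ 0 < r, 0 < k' & 0 < sin (w' - c)].
  by apply: pos; rewrite ?(ltW r0)// -(orient_nor ec ew') -cross_edge.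
have [_ r'1 s2] : [/\ 0 < r, 0 < r' & 0 < sin (c' - c)].
  by apply: pos; rewrite ?(ltW r0)// -(orient_nor ec ec').
have w'c := sin_gt0_lt_pi s1 ltac:(lra).
have c'c := sin_gt0_lt_pi s2 ltac:(lra).
have o2 : 0 < orient (P i.-1) (P i) (P i.+1).
  by apply: cl => //; rewrite leqnn prednK ?leqnn.
have [_ _ s3] : [/\ 0 < k, 0 < k' & 0 < sin (w' - w)].
  by apply: pos; rewrite ?(ltW k0)// -(orient_nor ew ew') -cross_edge.
have w'w : 0 < w' - w by apply: sin_gt0_gt0 s3 _; lra.
have [_ _ s4] : [/\ 0 < r', 0 < k' & 0 < sin (w' - c')].
  apply: pos => //; rewrite -(orient_nor ec' ew').
  by move: o1; rewrite /orient !mxE; lra.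
have w'c' : 0 < w' - c' by apply: sin_gt0_gt0 s4 _; lra.
have c'w0 : c' < w0 + pi.
  have o3 : 0 < orient (P 0) (P 1) (P i.+1).
    have [i1|i1] := eqVneq i 1%N; first by move: o1; rewrite i1.
    by apply: cl => //=; rewrite ltnS ltn_neqAle eq_sym i1.
  have [_ _ s5] : [/\ 0 < r1, 0 < r' & 0 < sin (c' - w0)].
    by apply: pos; rewrite ?(ltW r10)// -(orient_nor e1 ec').
  by have := sin_gt0_lt_pi s5; rewrite (mulr2n pi); lra.
have := IH i.+1 isT _ c' w' r' k' r'1 k'1 ec' ew'.
rewrite -im addSnnS => /(_ erefl); rewrite im => tail.
have {}tail := tail ltac:(lra) ltac:(lra) c'w0.
rewrite big_ltn// modn_small//.
have -> : enorm (P i.+1 - P i) = dot (P i.+1 - P i) (nor w').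
  by rewrite ew' enormZ enorm_nor mulr1 dotZl dot_nor subrr cos0 mulr1 gtr0_norm.
have ww : w <= w' by lra.
have := increment_point (mem_nth 0 il) ww; move: tail.
by rewrite dotBl /P; lra.
Qed.

(** Cauchy's formula, as an inequality for an inscribed polygon. *)
Lemma polygon_length_le : polygon_length l = 0 \/
  exists w, polygon_length l <= H (w + pi *+ 2) - H w.
Proof.
have p0 := pi_gt0 R.
have [l1|l1] := ltnP 1 (size l); last first.
  left; rewrite /polygon_length big1// => -[i il] _ /=.
  have -> : i = 0%N by move: il l1; case: (size l) => [|[|?]] //; case: i.
  by case: (size l) il l1 => [|[|]]//; rewrite modn1 subrr enorm0.
have [e01|ne] := eqVneq (P 0) (P 1).
  have l2 : size l = 2.
    apply/eqP; rewrite eqn_leq l1 andbT leqNgt; apply/negP => l3.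
    have := @cl 0%N 1%N 2%N isT l3; rewrite /orient -/(P 0) -/(P 1) e01 !mxE; lra.
  left; rewrite /polygon_length l2 !big_ord_recl big_ord0 /= -/(P 0) -/(P 1) e01.
  by rewrite !subrr enorm0 !addr0.
right.
have [w _ ew] := polar_nor (P 1 - P 0) 0.
have r0 : 0 < enorm (P 1 - P 0).
  rewrite lt_def enorm_ge0 andbT; apply: contra_neq ne => /enorm_eq0/eqP.
  by rewrite subr_eq0 => /eqP.
have := @polygon_tail w _ r0 ew (size l).-2 1 isT _ w w _ _ r0 r0 ew ew.
have -> : (1 + (size l).-2.+1)%N = m by rewrite add1n /m; case: (size l) l1 => [|[|]].
move=> /(_ erefl); rewrite lexx => /(_ isT) tail; exists w.
have {}tail := tail ltac:(lra) ltac:(lra).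
rewrite /polygon_length -(big_mkord xpredT (fun j => enorm (P (j.+1 %% m) - P j))).
rewrite big_ltn ?modn_small//; last exact: ltnW.
have -> : enorm (P 1 - P 0) = dot (P 1 - P 0) (nor w).
  by rewrite {2}ew dotZl dot_nor subrr cos0 mulr1.
by move: tail; rewrite dotBl; lra.
Qed.

End Turning.

End ConvexPolygons.

Section ThreeDisks.
Context (R : realType).
Implicit Types (x y z p q : 'rV[R]_2) (a b c t : R).

(** The equilateral triangles of side [1] with vertices in counterclockwise
    order; [t] is the direction of the first side. *)
Definition ccw_triangle t p q r := [/\ q - p = dir t,
  r - q = dir (t + 2 * (pi / 3)) & p - r = dir (t + 4 * (pi / 3)) :> 'rV[R]_2].

Section Increments.
Variables (K : set 'rV[R]_2) (H : R -> R) (s : R).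
Hypotheses (K0 : K !=set0) (cK : compact K) (s0 : 0 < s).
Hypothesis dH : forall t, deriv_at H t (supportfun K t).

Lemma period_const a b : H (a + pi *+ 2) - H a = H (b + pi *+ 2) - H b.
Proof.
apply: (@is_derive_0_is_cst R (fun t => H (t + pi *+ 2) - H t)) => t.
rewrite -(subrr (supportfun K t)); apply: deriv_add; last exact: deriv_opp.
by apply: deriv_shift; rewrite -[X in deriv_at _ _ X](supportD2pi K t).
Qed.

Lemma arc_increment o a b : (forall x, K x -> enorm (x - o) <= s) -> a <= b ->
  H b - H a <= s * (b - a) + dot o (nor a) - dot o (nor b).
Proof.
move=> ho ab.
have : H b - H a <= (s * b + - dot o (nor b)) - (s * a + - dot o (nor a)).
  apply: (@increment_le R H (fun t => s * t + - dot o (nor t)) (supportfun K)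
    (fun t => s + dot o (dir t)) a b ab).
  - by move=> t _; exact: dH.
  - move=> t _; apply: deriv_add; last exact: deriv_dot_nor.
    by compute_derivative.
  - move=> t _; have [x Kx ->] := support_attained K0 cK t.
    by have := ho x Kx; have := dot_dir_le (x - o) t; rewrite dotBl; lra.
lra.
Qed.

Lemma corner_increment o p t B : (forall x, K x -> enorm (x - o) <= s) ->
  (forall x, K x -> enorm (x - p) <= s) -> p - o = dir t -> 0 <= B < pi / 2 ->
  2 * (s * sin B) = 1 ->
  H (t + pi / 2 + B) - H (t + pi / 2 - B) <=
  dot o (nor (t + pi / 2 - B)) - dot p (nor (t + pi / 2 + B)).
Proof.
move=> ho hp op B0 sB; have p0 := pi_gt0 R.
set c := t + pi / 2.
pose w := o + s *: dir (c - B).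
have wp : w = p + s *: dir (c + B).
  have e : dir (c + B) = dir (c - B) + (2 * sin B) *: nor c by rewrite -dir_chord [RHS]addrC subrK.
  have nc : nor c = - dir t by rewrite norE /c -addrA -splitr dirDpi.
  have -> : p = o + dir t by rewrite -op addrC subrK.
  rewrite e scalerDr scalerA mulrCA sB scale1r nc /w.
  by rewrite addrACA subrr addr0.
have h : H (c + B) - H (c - B) <= - dot w (nor (c + B)) - - dot w (nor (c - B)).
  apply: (@increment_le R H (fun t => - dot w (nor t)) (supportfun K)
    (fun t => dot w (dir t))); first lra.
  - by move=> u _; exact: dH.
  - by move=> u _; exact: deriv_dot_nor.
  - move=> u uB; have [x Kx ->] := support_attained K0 cK u.
    have cpi : c + B < c - B + pi by lra.
    have := corner_extreme s0 uB cpi erefl wp (ho x Kx) (hp x Kx).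
    by rewrite -/w dotBl; lra.
have e1 : dot w (nor (c - B)) = dot o (nor (c - B)).
  by rewrite /w dotDl dotZl dot_dirnor subrr sin0 mulr0 addr0.
have e2 : dot w (nor (c + B)) = dot p (nor (c + B)).
  by rewrite wp dotDl dotZl dot_dirnor subrr sin0 mulr0 addr0.
by rewrite e1 e2 in h; lra.
Qed.

(** The boundary of the intersection of the three disks consists of arcs of
    radius [s] over three ranges of directions, separated by three corners
    each of which takes up a range of width [2 * B]. *)
Lemma three_disks_increment t p q r B : ccw_triangle t p q r ->
  (forall x, K x -> [/\ enorm (x - p) <= s, enorm (x - q) <= s & enorm (x - r) <= s]) ->
  0 <= B <= pi / 3 -> 2 * (s * sin B) = 1 ->
  H (t + pi / 2 - B + pi *+ 2) - H (t + pi / 2 - B) <= 2 * pi * s - 6 * s * B.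
Proof.
move=> [pq qr rp] hK B3 sB; have p0 := pi_gt0 R.
have [hp hq hr] : [/\ forall x, K x -> enorm (x - p) <= s,
    forall x, K x -> enorm (x - q) <= s & forall x, K x -> enorm (x - r) <= s].
  by split=> x /hK[].
have B2 : 0 <= B < pi / 2 by apply/andP; split; lra.
have c1 := corner_increment hp hq pq B2 sB.
have c2 := corner_increment hq hr qr B2 sB.
have c3 := corner_increment hr hp rp B2 sB.
have a1 := @arc_increment q (t + pi / 2 + B) (t + 2 * (pi / 3) + pi / 2 - B) hq ltac:(lra).
have a2 := @arc_increment r (t + 2 * (pi / 3) + pi / 2 + B) (t + 4 * (pi / 3) + pi / 2 - B) hr ltac:(lra).
have a3 := @arc_increment p (t + 4 * (pi / 3) + pi / 2 + B) (t + pi / 2 - B + pi *+ 2) hp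
  ltac:(rewrite (mulr2n pi); lra).
rewrite norD2pi in a3; rewrite (mulr2n pi) in a3 *; lra.
Qed.

End Increments.

Lemma three_disks_perimeter (E : set 'rV[R]_2) t p q r s B : 0 < s ->
  ccw_triangle t p q r ->
  (forall x, bdry E x -> [/\ enorm (x - p) <= s, enorm (x - q) <= s & enorm (x - r) <= s]) ->
  0 <= B <= pi / 3 -> 2 * (s * sin B) = 1 ->
  (perimeter E <= (2 * pi * s - 6 * s * B)%:E)%E.
Proof.
move=> s0 tr hE B3 sB; apply: ge_ereal_sup => _ [l [cl bl] <-]; rewrite lee_fin.
have V0 : 0 <= 2 * pi * s - 6 * s * B.
  have -> : 2 * pi * s - 6 * s * B = s * (2 * pi - 6 * B) by ring.
  by apply: mulr_ge0; lra.
have [l0|l0] := eqVneq l [::]; first by rewrite l0 /polygon_length big_ord0.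
pose K : set 'rV[R]_2 := [set` l].
have K0 : K !=set0 by case: (l) l0 @K => // x l' _ K; exists x; rewrite /K/= mem_head.
have cK : compact K by apply: finite_compact; exact: finite_seq.
have [H dH] := primitive_exists (support_continuous K0 cK).
have hl : {in l, forall p t, dot p (dir t) <= supportfun K t}.
  by move=> x xl u; exact: support_ge.
have [->//|[w hw]] := polygon_length_le dH hl cl.
apply: le_trans hw _; rewrite (period_const dH w (t + pi / 2 - B)).
by apply: (three_disks_increment K0 cK s0 dH tr) => // x /bl/hE.
Qed.

End ThreeDisks.

(** * Reuleaux triangles *)

Section Reuleaux.
Context (R : realType).
Implicit Types (x y z p q r v : 'rV[R]_2) (a b c t : R).

Definition unit_triangle p q r :=
  [/\ enorm (p - q) = 1, enorm (q - r) = 1 & enorm (r - p) = 1].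

Lemma unit_triangle_swap p q r : unit_triangle p q r -> unit_triangle p r q.
Proof. by case=> *; split; rewrite enorm_distC. Qed.

Lemma reuleaux_swap p q r : reuleaux p q r = reuleaux p r q.
Proof. by rewrite /reuleaux setIAC. Qed.

Lemma cos_pi3 : cos (pi / 3) = 1 / 2 :> R.
Proof.
have -> : pi / 3 = - (pi / 6 - pi / 2) :> R by field.
by rewrite cosN cosBpihalf sin_pi6.
Qed.

Lemma dirD t c : dir (t + c) = cos c *: dir t + sin c *: nor t :> 'rV[R]_2.
Proof. by apply: row2P; rewrite !mxE/= ?cosD ?sinD; ring. Qed.

Lemma dir_pi3 t : dir (t + 2 * (pi / 3)) = dir (t + pi / 3) - dir t :> 'rV[R]_2.
Proof.
have -> : t + 2 * (pi / 3) = t + pi / 3 + pi / 3 by ring.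
have -> : t + pi / 3 + pi / 3 = t + (pi / 3 + pi / 3) by ring.
rewrite !dirD cosD sinD cos_pi3; have := @sin_pi3_sq R; rewrite expr2 => ->.
by apply: row2P; rewrite !mxE/=; field.
Qed.

Lemma dir_4pi3 t : dir (t + 4 * (pi / 3)) = - dir (t + pi / 3) :> 'rV[R]_2.
Proof. by rewrite -dirDpi; congr dir; field. Qed.

Lemma ccw_triangle_intro t p q r : q - p = dir t -> r - p = dir (t + pi / 3) ->
  ccw_triangle t p q r.
Proof.
move=> qp rp; split=> //.
  by rewrite dir_pi3 -qp -rp opprB addrA subrK.
by rewrite dir_4pi3 -rp opprB.
Qed.

Lemma ccw_triangle_exists p q r : unit_triangle p q r ->
  exists t, ccw_triangle t p q r \/ ccw_triangle t p r q.
Proof.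
move=> [pq qr rp].
have [t _ e] := polar (q - p) 0; rewrite enorm_distC pq scale1r in e.
have d := frame_decomp (r - p) t.
set x := dot _ (dir t) in d; set y := dot _ (nor t) in d.
have n2 (u v : R) : dot (u *: dir t + v *: nor t) (u *: dir t + v *: nor t) = u * u + v * v.
  rewrite !dot_lin !dot_dir !dot_nor !dot_dirnor !dot_nordir !subrr cos0 sin0; ring.
have r1 : x * x + y * y = 1 by rewrite -n2 -d -enorm_sq rp expr1n.
have r2 : (x - 1) * (x - 1) + y * y = 1.
  rewrite -n2 scalerBl scale1r addrAC -d -e opprB addrA subrK.
  by rewrite -enorm_sq enorm_distC qr expr1n.
have x2 : x = 1 / 2 by lra.
have s3 := @sin_pi3_sq R; rewrite expr2 in s3.
have : (y - sin (pi / 3)) * (y + sin (pi / 3)) = 0.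
  by move: r1; rewrite x2 => r1; lra.
move=> /eqP; rewrite mulf_eq0 => /orP[/eqP y1|/eqP y1].
  exists t; left; apply: ccw_triangle_intro => //.
  by rewrite d dirD cos_pi3 x2; congr (_ + _ *: _); lra.
exists (t - pi / 3); right; apply: ccw_triangle_intro.
  rewrite d dirD cosN sinN cos_pi3 x2; congr (_ + _ *: _); lra.
by rewrite subrK.
Qed.

Lemma cone_ineq (V p0 p1 l m : R) : 0 <= V <= 1 -> V <= 2 * p0 -> V <= 2 * p1 ->
  0 <= l -> 0 <= m -> l * l + m * m + l * m <= 1 ->
  V - 2 * (l * p0 + m * p1) + (l * l + m * m + l * m) <= 1.
Proof.
move=> V01 v0 v1 l0 m0 lm.
have h0 : l * V <= l * (2 * p0) by rewrite ler_wpM2l.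
have h1 : m * V <= m * (2 * p1) by rewrite ler_wpM2l.
have [le|gt] := leP 1 (l + m).
  have : 0 <= V * (l + m - 1) by apply: mulr_ge0; lra.
  lra.
have h2 : 0 <= (1 - V) * (1 - (l + m)) by apply: mulr_ge0; lra.
have h3 : 0 <= (l + m) * (1 - (l + m)) by apply: mulr_ge0; lra.
have h4 : 0 <= l * m by apply: mulr_ge0.
lra.
Qed.

(** If [l + m <= 1] then [z] is a convex combination of the vertices, to all of
    which [x] is close. Otherwise the inner product of [x - p] and [z - p] is at
    least half of the square of [x - p], since this holds for the two sides. *)
Lemma cone_dist p q r x z l m : unit_triangle p q r ->
  z - p = l *: (q - p) + m *: (r - p) -> 0 <= l -> 0 <= m ->
  enorm (z - p) <= 1 -> reuleaux p q r x -> enorm (x - z) <= 1.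
Proof.
move=> [pq qr rp] ez l0 m0 zp [[xp xq] xr].
have uu : dot (q - p) (q - p) = 1 by rewrite -enorm_sq enorm_distC pq expr1n.
have vv : dot (r - p) (r - p) = 1 by rewrite -enorm_sq rp expr1n.
have uv : dot (q - p) (r - p) = 1 / 2.
  have : dot (q - r) (q - r) = 1 by rewrite -enorm_sq qr expr1n.
  have -> : q - r = (q - p) - (r - p) by rewrite opprB addrA subrK.
  by rewrite (dotBl (q - p)) !(dotBr (q - p)) uu vv (dotC (r - p)); lra.
have xz : x - z = (x - p) - (z - p) by rewrite opprB addrA subrK.
have xq' : x - q = (x - p) - (q - p) by rewrite opprB addrA subrK.
have xr' : x - r = (x - p) - (r - p) by rewrite opprB addrA subrK.
move: xp xq xr zp; rewrite /disk/= xz xq' xr' ez.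
move: (x - p) (q - p) (r - p) uu vv uv => v u w uu vv uv.
rewrite !enorm_le// !expr1n !dot_lin uu vv (dotC w u) uv (dotC u v) (dotC w v).
move=> v1 vu vw lm.
have := @cone_ineq (dot v v) (dot v u) (dot v w) l m.
rewrite dot_ge0 v1 => /(_ isT); move=> h.
have := h ltac:(lra) ltac:(lra) l0 m0 ltac:(lra); lra.
Qed.

Lemma barycentric p q r z : unit_triangle p q r ->
  exists l m, z - p = l *: (q - p) + m *: (r - p).
Proof.
move=> tr; have p0 := pi_gt0 R.
wlog [t [qp rq pr]] : q r tr / exists t, ccw_triangle t p q r.
  move=> h; have [t [h1|h1]] := ccw_triangle_exists tr.
    by apply: h => //; exists t.
  have [|m [l e]] := h r q (unit_triangle_swap tr); first by exists t.
  by exists l, m; rewrite [RHS]addrC.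
have rp : r - p = dir (t + pi / 3) by rewrite -opprB pr dir_4pi3 opprK.
pose k : R := sin (pi / 3).
have k0 : k != 0 by rewrite gt_eqF// /k sin_gt0_pi//; lra.
pose m := dot (z - p) (nor t) / k.
exists (dot (z - p) (dir t) - m / 2), m.
rewrite qp rp dirD cos_pi3 -/k.
rewrite {1}(frame_decomp (z - p) t) scalerDr !scalerA addrA -scalerDl.
by congr (_ *: _ + _ *: _); rewrite /m; field.
Qed.

Lemma unit_triangle_rot p q r : unit_triangle p q r -> unit_triangle q r p.
Proof. by case=> *; split. Qed.

Lemma far_vertex p q r z l m : unit_triangle p q r ->
  z - p = l *: (q - p) + m *: (r - p) -> l < 0 -> 1 < l + m -> 1 < enorm (z - p).
Proof.
move=> [pq qr rp] -> l0 lm.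
have uu : dot (q - p) (q - p) = 1 by rewrite -enorm_sq enorm_distC pq expr1n.
have vv : dot (r - p) (r - p) = 1 by rewrite -enorm_sq rp expr1n.
have uv : dot (q - p) (r - p) = 1 / 2.
  have : dot (q - r) (q - r) = 1 by rewrite -enorm_sq qr expr1n.
  have -> : q - r = (q - p) - (r - p) by rewrite opprB addrA subrK.
  by rewrite (dotBl (q - p)) !(dotBr (q - p)) uu vv (dotC (r - p)); lra.
rewrite ltNge enorm_le// -ltNge expr1n.
move: (q - p) (r - p) uu vv uv => u w uu vv uv.
rewrite !dot_lin uu vv (dotC w u) uv; nra.
Qed.

(** Two barycentric coordinates of [z] are nonnegative, since a point of the
    opposite cone at a vertex is too far from another vertex. This puts [z] into
    the cone of the triangle at some vertex. *)
Lemma reuleaux_diam p q r x z : unit_triangle p q r ->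
  reuleaux p q r x -> reuleaux p q r z -> enorm (x - z) <= 1.
Proof.
move=> tr Rx Rz; have [l [m e]] := barycentric z tr.
have [[zp zq] zr] := Rz; rewrite /disk/= in zp zq zr.
have eq_ : z - q = (1 - l - m) *: (p - q) + m *: (r - q).
  rewrite -(subrK p z) e; apply: row2P; rewrite !mxE; ring.
have er : z - r = (1 - l - m) *: (p - r) + l *: (q - r).
  rewrite -(subrK p z) e; apply: row2P; rewrite !mxE; ring.
have Rq : reuleaux q p r x by have [[? ?] ?] := Rx.
have Rr : reuleaux r p q x by have [[? ?] ?] := Rx.
have tq : unit_triangle q p r by apply/unit_triangle_swap/unit_triangle_rot.
have trr : unit_triangle r p q by apply/unit_triangle_rot/unit_triangle_rot.
have [l0|l0] := leP 0 l; have [m0|m0] := leP 0 m.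
- exact: cone_dist tr e l0 m0 zp Rx.
- have [k0|k0] := leP 0 (1 - l - m).
    exact: cone_dist trr er k0 l0 zr Rr.
  have := far_vertex (unit_triangle_swap tr) (etrans e (addrC _ _)) m0 ltac:(lra).
  by rewrite ltNge zp.
- have [k0|k0] := leP 0 (1 - l - m).
    exact: cone_dist tq eq_ k0 m0 zq Rq.
  have := far_vertex tr e l0 ltac:(lra).
  by rewrite ltNge zp.
- have := far_vertex (unit_triangle_swap tq) (etrans eq_ (addrC _ _)) m0 ltac:(lra).
  by rewrite ltNge zq.
Qed.

(** A body of constant width containing the three vertices lies in the Reuleaux
    triangle, and cannot be enlarged without increasing its diameter. *)
Lemma width_one_reuleaux K p q r : width_one K -> K p -> K q -> K r ->
  unit_triangle p q r -> K = reuleaux p q r.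
Proof.
move=> hK Kp Kq Kr tr; have [_ _ hd _] := hK.
have sub x : K x -> reuleaux p q r x.
  by move=> Kx; split; [split|]; exact: (diam_le1 hK).
apply/seteqP; split=> x; first exact: sub.
by move=> Rx; apply/hd => z Kz; exact: reuleaux_diam tr Rx (sub z Kz).
Qed.

Lemma compact_disk_sub (K : set 'rV[R]_2) p : closed K -> K `<=` disk p 1 -> compact K.
Proof.
move=> cK Kp.
have cB := @rV_compact R 2 (fun i => `[p 0 i - 1, p 0 i + 1]%classic)
  (fun i => @segment_compact R _ _).
apply: subclosed_compact cK cB _ => x /Kp; rewrite /disk/= => xp i.
have := coord_enorm (x - p) i; rewrite !mxE/= in_itv/= ler_norml; lra.
Qed.

Lemma closed_disk p s : 0 <= s -> closed (disk p s).
Proof.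
move=> s0; have -> : disk p s = (fun x => dot (x - p) (x - p)) @^-1` [set r | r <= s ^+ 2].
  by apply/seteqP; split=> x; rewrite /disk/= enorm_le.
apply: preimage_closed; last exact: closed_le.
by move=> x _; exact: dist2_continuous.
Qed.

Lemma closed_reuleaux p q r : closed (reuleaux p q r).
Proof. by apply: closedI; [apply: closedI|]; exact: closed_disk. Qed.

Lemma compact_reuleaux p q r : compact (reuleaux p q r).
Proof. by apply: (compact_disk_sub (@closed_reuleaux p q r) (p := p)) => x [[]]. Qed.

Lemma inner_parallel_reuleaux p q r t x : inner_parallel (reuleaux p q r) t x ->
  [/\ enorm (x - p) <= 1 - t, enorm (x - q) <= 1 - t & enorm (x - r) <= 1 - t].
Proof.
by move=> h; split; apply: (inner_parallel_le (@compact_reuleaux p q r) _ h) => y [[]].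
Qed.

(** Among all points the centre of the triangle has the least sum of squared
    distances to the vertices. *)
Lemma vertex_far p q r x s : unit_triangle p q r -> enorm (x - p) <= s ->
  enorm (x - q) <= s -> enorm (x - r) <= s -> 1 <= 3 * s ^+ 2 /\ 0 <= s.
Proof.
move=> [pq qr rp] xp xq xr; have s0 := le_trans (enorm_ge0 _) xp; split => //.
have sq v : enorm v = 1 -> dot v v = 1 by rewrite -enorm_sq => ->; rewrite expr1n.
move: xp xq xr (sq _ pq) (sq _ qr) (sq _ rp); rewrite !enorm_le// !dotE !mxE.
move: (x 0 0) (x 0 1) (p 0 0) (p 0 1) (q 0 0) (q 0 1) (r 0 0) (r 0 1) => x0 x1 p0 p1 q0 q1 r0 r1.
have := sqr_ge0 (3 * x0 - p0 - q0 - r0); have := sqr_ge0 (3 * x1 - p1 - q1 - r1); nra.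
Qed.

Lemma inradius_reuleaux p q r : unit_triangle p q r ->
  inradius (reuleaux p q r) = 1 - Num.sqrt 3 / 3.
Proof.
move=> tr; set w := Num.sqrt 3 : R.
have w2 : w * w = 3 by rewrite -expr2 sqr_sqrtr.
have w0 : 0 <= w by exact: sqrtr_ge0.
have w1 : w <= 3 by nra.
have ub d : 0 <= d -> (exists x, disk x d `<=` reuleaux p q r) -> d <= 1 - w / 3.
  move=> d0 [x hx].
  have far v : (forall y, disk x d y -> enorm (y - v) <= 1) -> enorm (x - v) <= 1 - d.
    move=> h; have [t _ e] := polar (x - v) 0.
    have := h (x + d *: dir t); rewrite /disk/= addrAC subrr add0r enormZ enorm_dir mulr1.
    rewrite ger0_norm// => /(_ (lexx _)).
    have -> : x + d *: dir t - v = (enorm (x - v) + d) *: dir t by rewrite scalerDl -e addrAC.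
    by rewrite enormZ enorm_dir mulr1 ger0_norm ?addr_ge0 ?enorm_ge0//; lra.
  have [h3 h0] : 1 <= 3 * (1 - d) ^+ 2 /\ 0 <= 1 - d.
    by apply: (@vertex_far p q r x) => //; apply: far => y /hx[[]].
  by nra.
have in0 : [set r0 | 0 <= r0 /\ exists x, disk x r0 `<=` reuleaux p q r] (1 - w / 3).
  split; first lra.
  exists (3^-1 *: (p + q + r)) => y hy; rewrite /disk/= in hy.
  have [pq qr rp] := tr.
  have sq v : enorm v = 1 -> dot v v = 1 by rewrite -enorm_sq => ->; rewrite expr1n.
  have close v : dot (3^-1 *: (p + q + r) - v) (3^-1 *: (p + q + r) - v) = 1 / 3 -> enorm (y - v) <= 1.
    move=> hv; have : enorm (3^-1 *: (p + q + r) - v) <= w / 3.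
      by rewrite enorm_le ?divr_ge0// hv expr2; lra.
    by have := enorm_triangle y (3^-1 *: (p + q + r)) v; lra.
  have [e1 e2 e3] := And3 (sq _ pq) (sq _ qr) (sq _ rp).
  by split; [split|]; apply: close; move: e1 e2 e3; rewrite !dotE !mxE; lra.
apply/eqP; rewrite eq_le; apply/andP; split.
  by apply: ge_sup; [exists (1 - w / 3)|move=> d [d0 hd]; exact: ub].
by apply: ub_le_sup => //; exists (1 - w / 3) => d [d0 hd]; exact: ub.
Qed.

Definition rotation t : 'M[R]_2 := \matrix_(i, j)
  (if i == 0 then dir t else nor t) 0 j.

Lemma mul_rotation x t : x *m rotation t = x 0 0 *: dir t + x 0 1 *: nor t.
Proof.
apply/rowP => j; rewrite !mxE !big_ord_recl big_ord0 !mxE /= addr0.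
by have -> : lift ord0 ord0 = 1 :> 'I_2 by exact/val_inj.
Qed.

Lemma dir_rotation a t : dir a *m rotation t = dir (a + t).
Proof. by rewrite mul_rotation vec0 vec1 addrC [in RHS]addrC dirD addrC. Qed.

Lemma enorm_rotation x t : enorm (x *m rotation t) = enorm x.
Proof.
rewrite mul_rotation /enorm; congr Num.sqrt.
rewrite !dot_lin !dot_dir !dot_nor !dot_dirnor !dot_nordir !subrr cos0 sin0 dotE; ring.
Qed.

Lemma rotationN x t : x *m rotation (- t) *m rotation t = x.
Proof.
rewrite (mul_rotation x) mulmxDl -!scalemxAl !norE !dir_rotation addNr.
have -> : - t + pi / 2 + t = pi / 2 by ring.
by apply: row2P; rewrite !mxE/= ?(cos0, sin0, cos_pihalf, sin_pihalf); ring.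
Qed.

Lemma rotation_orthogonal t : rotation t *m (rotation t)^T = 1%:M.
Proof.
have cs := cos2Dsin2 t.
apply/matrixP => i j; rewrite !mxE !big_ord_recl big_ord0 !mxE addr0.
have -> : lift ord0 ord0 = 1 :> 'I_2 by exact/val_inj.
case: i => [[|[|//]] hi]; case: j => [[|[|//]] hj]; rewrite !mxE/= -?cs; ring.
Qed.

Lemma det_rotation t : \det (rotation t) = 1.
Proof.
rewrite (expand_det_row _ 0) !big_ord_recl big_ord0 /cofactor !det_mx11 !mxE/=.
rewrite -[RHS](cos2Dsin2 t) (_ : bump 0 0 = 1)// !add0n expr0 expr1; ring.
Qed.

Lemma congruent_reuleaux p q r p' q' r' : unit_triangle p q r -> unit_triangle p' q' r' ->
  exists f, rigid_motion f /\ reuleaux p' q' r' = f @` reuleaux p q r.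
Proof.
move=> tr tr'.
wlog [t [qp rq pr]] : q r tr / exists t, ccw_triangle t p q r.
  move=> h; have [t [h1|h1]] := ccw_triangle_exists tr; first by apply: h => //; exists t.
  have [|f [rf ef]] := h r q (unit_triangle_swap tr); first by exists t.
  by exists f; split; rewrite // (reuleaux_swap p q).
wlog [t' [qp' rq' pr']] : q' r' tr' / exists t, ccw_triangle t p' q' r'.
  move=> h; have [t' [h1|h1]] := ccw_triangle_exists tr'; first by apply: h => //; exists t'.
  have [|f [rf ef]] := h r' q' (unit_triangle_swap tr'); first by exists t'.
  by exists f; split; rewrite // (reuleaux_swap p' q').
pose Q := rotation (t' - t).
pose f x := x *m Q + (p' - p *m Q).
have fB x y : f x - f y = (x - y) *m Q.
  by rewrite /f mulmxBl opprD addrACA subrr addr0.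
have fdist x y : enorm (f x - f y) = enorm (x - y) by rewrite fB enorm_rotation.
have fp : f p = p' by rewrite /f addrC subrK.
have fq : f q = q'.
  have := fB q p; rewrite fp qp dir_rotation.
  have -> : t + (t' - t) = t' by ring.
  by rewrite -qp' => /addIr.
have fr : f r = r'.
  have := fB p r; rewrite fp pr dir_rotation.
  have -> : t + 4 * (pi / 3) + (t' - t) = t' + 4 * (pi / 3) by ring.
  by rewrite -pr' => /addrI/oppr_inj.
exists f; split.
  by exists Q, (p' - p *m Q); split; [exact: rotation_orthogonal|exact: det_rotation|].
apply/seteqP; split=> y.
  move=> [[yp yq] yr]; exists ((y - (p' - p *m Q)) *m rotation (- (t' - t))); last first.
    by rewrite /f rotationN subrK.
  set x := _ *m _.
  have fx : f x = y by rewrite /f /x rotationN subrK.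
  by split; [split|]; rewrite /disk/= -fdist fx ?fp ?fq ?fr.
move=> [x [[xp xq] xr] <-].
by split; [split|]; rewrite /disk/= -?fp -?fq -?fr fdist.
Qed.

End Reuleaux.

Theorem theorem5 (R : realType) (Omega : set 'rV[R]_2) (a b c : 'rV[R]_2)
    (hOmega : compact_convex Omega) (hwidth : constant_width Omega 1)
    (hab : enorm (a - b) = 1) (hbc : enorm (b - c) = 1)
    (hca : enorm (c - a) = 1) :
  [/\ inradius (reuleaux a b c) = (3 - Num.sqrt 3) / 3,
      (3 - Num.sqrt 3) / 3 = 1 - Num.sqrt 3 / 3 :> R,
      (forall t : R, 0 <= t ->
        (perimeter (inner_parallel Omega t) >=
         perimeter (inner_parallel (reuleaux a b c) t))%E) &
      (forall t : R, 0 < t <= inradius (reuleaux a b c) ->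
        perimeter (inner_parallel Omega t) =
          perimeter (inner_parallel (reuleaux a b c) t) ->
        exists f : 'rV[R]_2 -> 'rV[R]_2,
          rigid_motion f /\ Omega = f @` reuleaux a b c)].
Proof.
have hK := constant_width_one hOmega hwidth.
have tr : unit_triangle a b c by [].
have rE : (3 - Num.sqrt 3) / 3 = 1 - Num.sqrt 3 / 3 :> R by field.
have inr := inradius_reuleaux tr.
have w2 : Num.sqrt 3 ^+ 2 = 3 :> R by rewrite sqr_sqrtr.
have w0 : 0 <= Num.sqrt 3 :> R by exact: sqrtr_ge0.
have upper t B : 0 < 1 - t -> 0 < B <= pi / 3 -> sin (pi / 6) = (1 - t) * sin B ->
    (perimeter (inner_parallel (reuleaux a b c) t) <=
     (2 * pi * (1 - t) - 6 * (1 - t) * B)%:E)%E.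
  move=> s0 B3 sB; have near x : bdry (inner_parallel (reuleaux a b c) t) x ->
      [/\ enorm (x - a) <= 1 - t, enorm (x - b) <= 1 - t & enorm (x - c) <= 1 - t].
    move=> [clx _]; have cl p : (inner_parallel (reuleaux a b c) t `<=` disk p (1 - t)) -> enorm (x - p) <= 1 - t.
      move=> /closureS/(_ x clx); rewrite -(closure_id _).1//; exact: closed_disk (ltW s0).
    by split; apply: cl => y /inner_parallel_reuleaux[].
  have B3' : 0 <= B <= pi / 3 by lra.
  have sB' : 2 * ((1 - t) * sin B) = 1 by rewrite -sB sin_pi6; field.
  have [u [ccw|ccw]] := ccw_triangle_exists tr.
    exact: three_disks_perimeter s0 ccw near B3' sB'.
  by apply: three_disks_perimeter s0 ccw _ B3' sB' => x /near[].
have lower t : 0 <= t -> 0 < 1 - t -> 1 <= 3 * (1 - t) ^+ 2 ->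
    inner_parallel Omega t = ball_dual Omega (1 - t) /\ ball_dual Omega (1 - t) !=set0.
  move=> t0 s0 s3; split; first exact: inner_parallel_dual.
  by apply: jung => //; rewrite s0 gerBl.
split=> //; first by rewrite rE.
- move=> t t0; have [[x ix]|none] := pselect (inner_parallel (reuleaux a b c) t !=set0).
    have [xa xb xc] := inner_parallel_reuleaux ix.
    have [s3 s0] := vertex_far tr xa xb xc.
    have {}s0 : 0 < 1 - t by rewrite lt_def s0 andbT; apply/eqP => e; rewrite e in s3; lra.
    have [B [B3 sB _]] := corner_angle s0 s3.
    have [-> X0] := lower t t0 s0 s3.
    apply: le_trans (upper t B s0 B3 sB) _.
    apply: perimeter_lower_bound => //; first by rewrite s0 gerBl.
    by have := pi_gt0 R; lra.
  apply: le_trans (perimeter_ge0 _); apply: (@perimeter_le0 _ _ 0) => y [cy _].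
  have e0 : inner_parallel (reuleaux a b c) t = set0.
    by apply/seteqP; split=> // z iz; case: none; exists z.
  by move: cy; rewrite e0 closure0.
- move=> t; rewrite inr => /andP[t0 tr1] eqP.
  have s0 : 0 < 1 - t by nra.
  have s3 : 1 <= 3 * (1 - t) ^+ 2 by nra.
  have s1 : 0 < 1 - t < 1 by rewrite s0 gtrBl.
  have [B [B3 sB _]] := corner_angle s0 s3.
  have [iE X0] := lower t (ltW t0) s0 s3.
  have Bpi : 0 < B <= pi / 2 by have := pi_gt0 R; lra.
  have small := upper t B s0 B3 sB; rewrite -eqP iE in small.
  have [p [q [r [Kp Kq Kr tr']]]] := unit_triangle_of_near hK (fun e e0 =>
    near_triangle hK s1 X0 Bpi sB small e0).
  have [f [rf ef]] := congruent_reuleaux tr tr'.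
  by exists f; split; rewrite // -ef; exact: width_one_reuleaux hK Kp Kq Kr tr'.
Qed.
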